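(* Let $X$ be a connected, locally compact median space of finite rank whose isometry group acts transitively on $X$. Then $X$ is isometric to $(\mathbb{R}^n,\ell^1)$ for some integer $n\ge 0$.
   Context: All spaces are nonempty. For a metric space $(X,d)$ and $a,b\in X$, the interval is $[a,b]=\{x\in X : d(a,b)=d(a,x)+d(x,b)\}$. $(X,d)$ is a median space if for all $a,b,c\in X$ the intersection $[a,b]\cap[b,c]\cap[a,c]$ consists of exactly one point, denoted $m(a,b,c)$. A subset $C\subseteq X$ is convex if $[a,b]\subseteq C$ for all $a,b\in C$. A halfspace is a convex subset whose complement is also convex. Two halfspaces $\mathfrak h_1,\mathfrak h_2$ are transverse if all four intersections $\mathfrak h_1\cap\mathfrak h_2$, $\mathfrak h_1^c\cap\mathfrak h_2$, $\mathfrak h_1\cap\mathfrak h_2^c$, $\mathfrak h_1^c\cap\mathfrak h_2^c$ are nonempty. The rank of $X$ is the maximal cardinality of a family of pairwise transverse halfspaces (a single nonempty proper halfspace counts as a family of cardinality one). *)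

(* Defs.v *)
From HB Require Import structures.
From mathcomp Require Import all_boot all_order all_algebra.
From mathcomp Require Import all_classical all_reals all_analysis.

Set Implicit Arguments.
Unset Strict Implicit.
Unset Printing Implicit Defensive.

Import Order.TTheory GRing.Theory Num.Theory.

Local Open Scope classical_set_scope.
Local Open Scope card_scope.
Local Open Scope ring_scope.

Section Median.
Context {R : realType} {X : metricType R}.
Implicit Types (a b c x : X) (C h k : set X) (H : set (set X)).

Definition metric_interval a b : set X :=
  [set x | mdist a b = mdist a x + mdist x b].

Definition metric_convex C := forall a b, C a -> C b -> metric_interval a b `<=` C.

Definition halfspace h := metric_convex h /\ metric_convex (~` h).

Definition transverse h k :=
  [/\ h `&` k !=set0, ~` h `&` k !=set0,
      h `&` ~` k !=set0 & ~` h `&` ~` k !=set0].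

(* The condition that members are nonempty and proper only matters for
   families with at most one member: it follows from transversality as soon as
   there are two. *)
Definition transverse_family H :=
  (forall h, H h -> [/\ halfspace h, h !=set0 & ~` h !=set0]) /\
  (forall h k, H h -> H k -> h <> k -> transverse h k).

End Median.

Definition is_median (R : realType) (X : metricType R) :=
  forall a b c : X, exists m : X,
    metric_interval a b `&` metric_interval b c `&` metric_interval a c = [set m].

(* The rank of a one-point space is 0, attained by the empty family. *)
Definition has_rank (R : realType) (X : metricType R) (n : nat) :=
  (exists2 H : set (set X), transverse_family H & H #= `I_n) /\
  (forall H : set (set X), transverse_family H -> H #<= `I_n).

Definition finite_rank (R : realType) (X : metricType R) :=
  exists n, has_rank X n.

Definition is_isometry (R : realType) (X Y : metricType R) (f : X -> Y) :=
  bijective f /\ forall x y, mdist (f x) (f y) = mdist x y.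

Definition isometric (R : realType) (X Y : metricType R) :=
  exists f : X -> Y, is_isometry f.

Definition isometry_transitive (R : realType) (X : metricType R) :=
  forall x y : X, exists2 f : X -> X, is_isometry f & f x = y.

(* A copy of 'rV[R]_n, whose library instance carries the sup norm. *)
Definition l1space (R : realType) (n : nat) : Type := 'rV[R]_n.

Section L1.
Context {R : realType} {n : nat}.
Implicit Types x y z : l1space R n.

Definition l1dist x y : R :=
  \sum_(i < n) `|(x : 'rV[R]_n) ord0 i - (y : 'rV[R]_n) ord0 i|.

Lemma l1distxx x : l1dist x x = 0.
Proof. by rewrite /l1dist big1 // => i _; rewrite subrr normr0. Qed.

Lemma l1dist_positivity x y : l1dist x y = 0 -> x = y.
Proof.
move/eqP; rewrite psumr_eq0 => [/allP xy|i _]; last exact: normr_ge0.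
apply/rowP => i; apply/eqP; rewrite -subr_eq0 -normr_eq0.
exact: (xy i (mem_index_enum i)).
Qed.

Lemma l1dist_sym x y : l1dist x y = l1dist y x.
Proof. by apply: eq_bigr => i _; rewrite distrC. Qed.

Lemma l1dist_triangle y x z : l1dist x z <= l1dist x y + l1dist y z.
Proof.
rewrite /l1dist -big_split /=; apply: ler_sum => i _; exact: ler_distD.
Qed.

HB.instance Definition _ := Choice.copy (l1space R n) 'rV[R]_n.
HB.instance Definition _ := @isMetric.Build R (l1space R n)
  l1dist l1distxx l1dist_positivity l1dist_sym l1dist_triangle.

End L1.

(* Main.v *)
(* Betweenness in a median space is detected by walls, i.e. halfspaces viewed as
   maps to [bool]: these exist by Zorn's lemma, and reduce every implication
   between betweenness relations to a finite check on booleans.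

   Let [N] be the largest number of pairwise orthogonal segments issued from a
   point; it is at most the rank.  By maximality these segments are chains, hence
   real intervals by connectedness, and they span an l1 box; by homogeneity every
   point is the centre of such a box, of uniform size.  A family of segments
   issued from [x] with [x] between any two of their ends is called a star.  A box
   contains no star of more than [2 N] branches.  If [X] had a star of
   [2 N + 1] branches, then by homogeneity it would have one, of uniform size, at
   each point of the diagonal of a box, and each would have a branch leaving the
   box.  Branches at distinct points of the diagonal are uniformly far apart,
   since otherwise a common part would give [N + 1] orthogonal segments; this
   contradicts local compactness.  Hence boxes are neighbourhoods of their
   interior points.  It follows that every box can be enlarged by a fixed amount
   in every direction, and the union of an increasing sequence of boxes is
   isometric to R^N and is all of [X]. *)

Require Import Defs.
From mathcomp Require Import all_boot all_order all_algebra.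
From mathcomp Require Import all_classical all_reals all_analysis.
From mathcomp Require Import lra.

Set Implicit Arguments.
Unset Strict Implicit.
Unset Printing Implicit Defensive.

Import Order.TTheory GRing.Theory Num.Theory.
Import numFieldTopology.Exports.

Local Open Scope classical_set_scope.
Local Open Scope card_scope.
Local Open Scope ring_scope.

(** * Betweenness in a metric space *)

Section Betweenness.
Context {R : realType} {X : metricType R}.
Implicit Types a b c d e x y z : X.
Local Notation D := mdist.

Definition btw a x b := D a b = D a x + D x b.

Lemma btwC a x b : btw a x b -> btw b x a.
Proof. by rewrite /btw ![D b _]metric_sym [D x a]metric_sym addrC. Qed.

Lemma btw0 a b : btw a a b.
Proof. by rewrite /btw mdistxx add0r. Qed.

Lemma btw1 a b : btw a b b.
Proof. by rewrite /btw mdistxx addr0. Qed.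

Lemma btw_trans a y x b : btw a x b -> btw a y x -> btw a y b.
Proof.
rewrite /btw => h1 h2.
have := metric_triangle a y b; have := metric_triangle y x b; lra.
Qed.

Lemma btw_transr a y x b : btw a x b -> btw a y x -> btw y x b.
Proof.
rewrite /btw => h1 h2.
have := metric_triangle a y b; have := metric_triangle y x b; lra.
Qed.

Lemma btw_anti a b : btw a b a -> a = b.
Proof.
rewrite /btw mdistxx [D b a]metric_sym => h; apply: mdist_positivity; lra.
Qed.

Lemma btw_le a x b : btw a x b -> D a x <= D a b.
Proof. by move=> ->; rewrite lerDl mdist_ge0. Qed.

Lemma btw_eq_dist a x b : btw a x b -> D a x = D a b -> x = b.
Proof. by rewrite /btw => h1 h2; apply: mdist_positivity; lra. Qed.

End Betweenness.

Ltac dlra := rewrite /btw ?mdistxx;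
  repeat match goal with |- context [mdist ?x ?y] =>
    match goal with |- context [mdist y x] =>
      lazymatch x with y => fail | _ => rewrite [mdist y x]metric_sym end
    end end; lra.

(** * Gates, convexity and walls in a median space *)

Section Median.
Context {R : realType} {X : metricType R} (medX : is_median X).
Implicit Types a b c d e x y z : X.
Local Notation D := mdist.

Definition med a b c : X := projT1 (cid (medX a b c)).

Lemma medP a b c :
  [/\ btw a (med a b c) b, btw b (med a b c) c & btw a (med a b c) c].
Proof.
rewrite /med; case: cid => m /= /seteqP[_ /(_ m erefl)] [[]].
by rewrite /metric_interval /=.
Qed.

Lemma med_uniq a b c m : btw a m b -> btw b m c -> btw a m c -> m = med a b c.
Proof.
move=> h1 h2 h3; rewrite /med; case: cid => m' /= /seteqP[/(_ m) + _].
by apply; split.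
Qed.

Lemma med_btw a b x : btw a x b -> med a b x = x.
Proof. by move=> h; apply/esym/med_uniq => //; exact: btw1. Qed.

(** The medians [u] of [a, c, y] and [v] of [b, c, y] lie on a geodesic from [a] through [y] to [b].
    Hence [med u v c] is in all three intervals of [a], [b], [c], so it is [med a b c]; and it
    precedes [u] on the way from [c] to [y]. *)
Lemma med_gate a b c y : btw a y b -> btw c (med a b c) y.
Proof.
move=> yab.
have [u1 u2 u3] := medP a c y; have [v1 v2 v3] := medP b c y.
move: (med a c y) (med b c y) u1 u2 u3 v1 v2 v3 => u v u1 u2 u3 v1 v2 v3.
have [w1 w2 w3] := medP u v c; move: (med u v c) w1 w2 w3 => w w1 w2 w3.
have uvab : btw a w b.
  move: yab u3 v3 w1; rewrite /btw.
  have := metric_triangle a w b; have := metric_triangle u y v.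
  have := metric_triangle a u w; have := metric_triangle w v b.
  dlra.
have wac : btw a w c.
  by apply: btwC; apply: (btw_trans (btwC u1)); apply: btwC.
have wbc : btw b w c.
  by apply: btwC; apply: (btw_trans (btwC v1)); apply: btwC.
rewrite -(med_uniq uvab wbc wac).
by apply: (btw_trans u2); apply: btwC.
Qed.

(** If [p] is the gate of [z] on [[a, b]], then [D x y] exceeds [D x p + D p y] by twice [D z p], so
    [z = p]. *)
Lemma btw_convex a b x y z : btw a x b -> btw a y b -> btw x z y -> btw a z b.
Proof.
move=> xab yab zxy; have [h _ _] := medP a b z.
have := med_gate z xab; have := med_gate z yab.
move: h; move: (med a b z) => p h gy gx.
suff -> : z = p by [].
apply: mdist_positivity; move: zxy gx gy.
have := mdist_ge0 z p; have := metric_triangle x p y.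
dlra.
Qed.

(* With [p := med d e x] and [g] its gate on [[med d e a, med d e b]], the points
   [p] and [g] have the same gate on [[a, b]], which forces [p = g]. *)
Lemma med_morph d e a b x :
  btw a x b -> btw (med d e a) (med d e x) (med d e b).
Proof.
move=> xab.
have [pa _ _] := medP d e a; have [pb _ _] := medP d e b.
have [px _ _] := medP d e x.
have ga := fun y => @med_gate d e a y; have gb := fun y => @med_gate d e b y.
have gx := fun y => @med_gate d e x y.
move: (med d e a) (med d e b) (med d e x) pa pb px ga gb gx.
move=> a' b' p pa pb px ga gb gx.
have [gab gbp gap] := medP a' b' p; move: (med a' b' p) gab gbp gap.
move=> g gab gbp gap.
have gde : btw d g e by exact: btw_convex gab.
have gaP : btw a g p.
  apply: btwC; apply: (btw_trans (btwC (ga _ px))); exact: btwC.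
have gbP : btw b g p.
  apply: btwC; apply: (btw_trans (btwC (gb _ px))); exact: btwC.
have [y1 y2 y3] := medP a b g; have gy := @med_gate a b g x xab.
have y0 : med a b g = med a b p.
  by apply: med_uniq => //; [apply: btw_trans gbP _|apply: btw_trans gaP _].
have hp := @med_gate a b p x xab; rewrite -y0 in hp.
move: (med a b g) y1 y2 y3 gy hp => y y1 y2 y3 gy hp {y0}.
have ygp : btw y g p by apply: btw_transr gaP y3.
have xpg := gx _ gde.
suff -> : p = g by [].
apply: mdist_positivity; move: ygp xpg gy hp; rewrite /btw.
have := mdist_ge0 p g; dlra.
Qed.

Lemma med_morph3 d e a b c :
  med d e (med a b c) = med (med d e a) (med d e b) (med d e c).
Proof.
by have [h1 h2 h3] := medP a b c; apply: med_uniq; exact: med_morph.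
Qed.

Lemma med_lip a b x y : D (med a b x) (med a b y) <= D x y.
Proof.
have [px _ _] := medP a b x; have [py _ _] := medP a b y.
have h1 := med_gate x py; have h2 := med_gate y px.
move: h1 h2; move: (med a b x) (med a b y) => p q.
have := metric_triangle x y q; have := metric_triangle y x p.
dlra.
Qed.

(** Project by [med x z], which preserves betweenness. Seen from [x], the images [d1], [d2] of [c1],
    [c2] lie beyond those of [y1], [y2], so [z] is between them and [med c1 c2 z] is sent to [z]. *)
Lemma join_convex (C : set X) x : metric_convex C ->
  metric_convex [set y | exists2 c, C c & btw c y x].
Proof.
move=> cC y1 y2 [c1 Cc1 h1] [c2 Cc2 h2] z zy.
have zy' : btw y1 z y2 := zy.
exists (med c1 c2 z); first by apply: (cC c1 c2) => //; case: (medP c1 c2 z).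
have e : med x z (med c1 c2 z) = z.
  rewrite med_morph3.
  have zz : med x z z = z by apply: med_btw; exact: btw1.
  rewrite zz; have := med_morph x z zy'; rewrite zz.
  have k1 := med_morph x z h1; have k2 := med_morph x z h2.
  have xx : med x z x = x by apply: med_btw; exact: btw0.
  rewrite xx in k1 k2.
  have [l1 _ _] := medP x z c1; have [l2 _ _] := medP x z c2.
  move: (med x z y1) (med x z y2) (med x z c1) (med x z c2) k1 k2 l1 l2.
  move=> u1 u2 d1 d2 k1 k2 l1 l2 zu.
  have m1 : btw u1 d1 z by apply: btw_transr l1 _; exact: btwC.
  have m2 : btw u2 d2 z by apply: btw_transr l2 _; exact: btwC.
  apply: med_btw; move: zu m1 m2; rewrite /btw.
  have := metric_triangle d1 z d2; have := metric_triangle u1 d1 u2.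
  have := metric_triangle d1 d2 u2; dlra.
by have [_ _] := medP x z (med c1 c2 z); rewrite e; exact: btwC.
Qed.

Definition wall (f : X -> bool) :=
  forall a b x, btw a x b -> (f a == f b) ==> (f x == f a).

Lemma wall_med f a b c : wall f ->
  f (med a b c) = if f a == f b then f a else f c.
Proof.
move=> wf; have [h1 h2 h3] := medP a b c.
move: (wf _ _ _ h1) (wf _ _ _ h2) (wf _ _ _ h3).
by case: (f a) (f b) (f c) (f (med a b c)) => [] [] [] [].
Qed.

(** By maximality the join of [C] with any point outside [C] contains [b]. If [z] in [C] were
    between two outside points, projection to [[b, c]] would put [b] between [c] and [med c' z b],
    both in [C]. *)
Lemma max_convex_compl (C : set X) b : metric_convex C -> ~ C b ->
  (forall E, C `<=` E -> metric_convex E -> ~ E b -> E `<=` C) ->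
  metric_convex (~` C).
Proof.
move=> cC Cb maxC x y nCx nCy z zxy Cz.
have H w : ~ C w -> exists2 c, C c & btw c b w.
  move=> nCw; apply: contrapT => nb; apply: nCw.
  apply: (maxC [set y | exists2 c, C c & btw c y w]) => //.
  - by move=> c Cc; exists c => //; exact: btw0.
  - exact: join_convex.
  - by exists z => //; exact: btw1.
have [c Cc hc] := H _ nCx; have [c' Cc' hc'] := H _ nCy.
have wC : C (med c' z b) by apply: (cC c' z) => //; case: (medP c' z b).
apply: Cb; apply: (cC c (med c' z b)) => //.
suff e : med b c (med c' z b) = b.
  by have [_ + _] := medP b c (med c' z b); rewrite e.
have bb : med b c b = b by apply: med_btw; exact: btw0.
have xx : med b c x = b.
  by apply/esym/med_uniq; [exact: btw0|exact: hc|exact: btw0].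
have zxy' : btw x z y := zxy.
have := med_morph b c zxy'; have := med_morph b c hc'.
rewrite med_morph3 bb xx.
move: (med b c y) (med b c c') (med b c z) => v u w k1 k2.
apply/esym/med_uniq; [|exact: btw1|exact: btw1].
move: k1 k2.
have := metric_triangle u b w; have := metric_triangle u w v; dlra.
Qed.

Lemma wall_sep a b : a <> b -> exists2 f, wall f & f a != f b.
Proof.
move=> ab.
(* The last clause admits the empty set, the union of the empty chain. A maximal member does contain
   [a], being otherwise empty and smaller than [[set a]]. *)
pose P (C : set X) := metric_convex C /\ ~ C b /\ (C !=set0 -> C a).
have [|C [[cC [Cb Ca]] maxC]] := @Zorn_bigcup _ P.
  move=> F FP tot; split; [|split].
  - move=> x y [A FA Ax] [B FB By] z zxy.
    have [AB|BA] := tot _ _ FA FB.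
    + by exists B => //; have [cB _] := FP _ FB; apply: cB zxy => //; exact: AB.
    + by exists A => //; have [cA _] := FP _ FA; apply: cA zxy => //; exact: BA.
  - by move=> [A FA Ab]; have [_ []] := FP _ FA.
  - move=> [x [A FA Ax]]; exists A => //; have [_ [_]] := FP _ FA; apply.
    by exists x.
have maxC' E : C `<=` E -> metric_convex E -> ~ E b -> E a -> E `<=` C.
  move=> CE cE Eb Ea; apply: contrapT => nEC.
  by apply: (maxC E) => //; split => // _.
have {}Ca : C a.
  apply: contrapT => nCa; have C0 : C `<=` [set a].
    by move=> x Cx; case: nCa; apply: Ca; exists x.
  apply: nCa; apply: (maxC' [set a]) => // [x y -> ->|/esym //] z zaa.
  by apply/esym; apply: btw_anti; exact: zaa.
have cc : metric_convex (~` C).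
  apply: (max_convex_compl cC Cb) => E CE cE Eb.
  by apply: maxC' => //; exact: CE.
exists (fun x => `[< C x >]).
  move=> x y z zxy; apply/implyP => /eqP; case: asboolP => Cx; case: asboolP => Cy // _.
    by apply/eqP/asboolP; exact: cC zxy.
  by apply/eqP/asboolP; apply: cc zxy.
by rewrite asboolT // asboolF.
Qed.

Lemma btwP a x b :
  (forall f, wall f -> (f a == f b) ==> (f x == f a)) -> btw a x b.
Proof.
move=> H; suff -> : x = med a b x by case: (medP a b x).
apply: contrapT => /wall_sep [f wf]; rewrite wall_med //.
by move: (H _ wf); case: (f a) (f b) (f x) => [] [] [].
Qed.

Lemma wall_eq a b : (forall f, wall f -> f a == f b) -> a = b.
Proof.
move=> H; apply: contrapT => /wall_sep [f wf]; by rewrite H.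
Qed.

End Median.

(** The cases double with each point that occurs, so some callers first trim the context; they keep
    [medX], which [eassumption] looks for. *)
Ltac walls :=
  let f := fresh "f" in let wf := fresh "wf" in
  first [apply: btwP | apply: wall_eq]; [eassumption|];
  move=> f wf;
  repeat match goal with H : btw _ _ _ |- _ =>
    generalize (wf _ _ _ H); clear H end;
  rewrite ?wall_med //;
  repeat match goal with |- context [f ?y] => case: (f y) => //= end.

(** * Rectangles, orthogonal frames and the rank *)

Section Frames.
Context {R : realType} {X : metricType R} (medX : is_median X).
Implicit Types a b c d e p u v w x y z : X.
Local Notation D := mdist.

(** The corners are listed in cyclic order, [p] being opposite to [w]. Degenerate rectangles are
    allowed. *)
Definition rect p u w v := [/\ btw p u w, btw p v w, btw u p v & btw u w v].

Definition orth p u v := exists w, rect p u w v.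

Lemma rectC p u w v : rect p u w v -> rect p v w u.
Proof. by case=> *; split => //; exact: btwC. Qed.

Lemma orthC p u v : orth p u v -> orth p v u.
Proof. by case=> w /rectC; exists w. Qed.

Lemma rect_dist p u w v : rect p u w v -> D p u = D v w /\ D p v = D u w.
Proof. by case=> h1 h2 h3 h4; split; move: h1 h2 h3 h4; dlra. Qed.

Definition frame (T : finType) p (u : T -> X) :=
  (forall t, u t <> p) /\ (forall s t, s != t -> orth p (u s) (u t)).

(** Take for each [t] a wall between [p] and [u t]. A wall that cuts one side of a rectangle cuts
    the opposite side and no other, so the four corners of the rectangle on [u s] and [u t] show
    that the two halfspaces are transverse. *)
Lemma frame_rank (r : nat) (T : finType) p (u : T -> X) :
  has_rank X r -> frame p u -> (#|T| <= r)%N.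
Proof.
move=> [_ rk] [up uo].
have /choice[f fP] t : exists f : X -> bool, wall f /\ f (u t) != f p.
  by have [f wf ft] := wall_sep medX (up t); exists f.
pose h (t : T) : set X := [set x | f t x].
have tr s t : s != t -> transverse (h s) (h t).
  move=> /uo[w [h1 h2 h3 h4]].
  have [ws] := fP s; have [wt] := fP t.
  move: (ws _ _ _ h1) (ws _ _ _ h2) (ws _ _ _ h3) (ws _ _ _ h4).
  move: (wt _ _ _ h1) (wt _ _ _ h2) (wt _ _ _ h3) (wt _ _ _ h4).
  case pt: (f t p); case ps: (f s p);
    case ss: (f s (u s)); case tt: (f t (u t));
    case st: (f s (u t)); case ts: (f t (u s));
    case sw: (f s w); case tw: (f t w) => // *;
  by split; (exists p + exists w + exists (u s) + exists (u t));
    rewrite /h /setI /setC /= ?pt ?ps ?ss ?tt ?st ?ts ?sw ?tw; split.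
have hinj : injective h.
  move=> s t hst; apply/eqP; apply: contrapT => /negP /tr.
  by rewrite hst => -[_ [x [nx hx]]].
have HF : transverse_family (range h).
  split.
    move=> _ [t _ <-]; have [wt ft] := fP t; split.
    - split=> a b; rewrite /h /setC /= => fa fb x abx /=.
        by move: (wt _ _ _ abx); rewrite fa fb /= => /eqP.
      by move: (wt _ _ _ abx); move/negP/negbTE: fa => ->;
        move/negP/negbTE: fb => -> /= /eqP ->.
    - case ut: (f t (u t)); first by exists (u t).
      by exists p => /=; move: ft; rewrite ut /h /=; case: (f t p).
    - case ut: (f t (u t)); last by exists (u t); rewrite /h /setC /= ut.
      by exists p; move: ft; rewrite ut /h /setC /=; case: (f t p).
  by move=> _ _ [s _ <-] [t _ <-] st; apply: tr; apply/eqP => e; rewrite e in st.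
have [->//|/card_gt0P[t0 _]] := posnP #|T|.
pose g i := h (nth t0 (enum T) i).
have ginj : {in `I_#|T| &, injective g}.
  move=> i j; rewrite !inE cardE => iT jT /hinj /eqP.
  by rewrite nth_uniq ?enum_uniq // => /eqP.
rewrite -card_le_II -(card_le_eql (inj_card_eq ginj)).
apply: card_le_trans (rk _ HF); apply: subset_card_le.
by move=> _ [i _ <-]; exists (nth t0 (enum T) i).
Qed.

(* The corners of the rectangles at [p] allow the frame to be translated to any
   point [c] of the edge [[p, u i]]. *)
Lemma frame_translate (T : finType) p (u : T -> X) i x y :
  frame p u -> btw p x (u i) -> btw p y (u i) ->
  let c := med medX p x y in x <> c -> y <> c ->
  exists v : option T -> X, frame c v.
Proof.
move=> [up uo] px py c xc yc.
have /choice[w wP] j : exists w, i != j -> rect p (u i) w (u j).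
  by case: (eqVneq i j) => [_|/uo [w]]; [exists p|exists w].
(* The gate of [c] on the side [[u j, w j]] opposite to [[p, u i]]: it is [u j] moved along as [p]
   moves to [c]. In the new frame [x] takes the index [i] and [y] the additional index. *)
pose t j := med medX c (u j) (w j).
exists (fun o => if o is Some j then if j == i then x else t j else y); split.
  case=> [j|]//; case: eqVneq => // ji tc; apply: (up j).
  have [|h1 h2 h3 h4] := wP j; first by rewrite eq_sym.
  move: tc; rewrite /t /c => tc; apply: (wall_eq medX) => f wf.
  have := congr1 f tc; rewrite !wall_med //.
  move: (wf _ _ _ px) (wf _ _ _ py) (wf _ _ _ h1) (wf _ _ _ h2) (wf _ _ _ h3)
    (wf _ _ _ h4).
  by case: (f p); case: (f x); case: (f y); case: (f (u i)); case: (f (u j));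
    case: (f (w j)).
have oxy : orth c x y.
  exists (med medX x y (u i)).
  by split; rewrite /c; walls.
have oj j z : j != i -> btw p z (u i) -> btw p c z -> orth c (t j) z.
  rewrite eq_sym => /wP[h1 h2 h3 h4] pz cz.
  exists (med medX z (u j) (w j)).
  by split; rewrite /t; walls.
have ox j : j != i -> orth c (t j) x.
  by move=> ji; apply: oj => //; rewrite /c; case: (medP medX p x y).
have oy j : j != i -> orth c (t j) y.
  by move=> ji; apply: oj => //; rewrite /c; case: (medP medX p x y).
have ot j k : j != i -> k != i -> j != k -> orth c (t j) (t k).
  move=> ji ki jk; have [w' [k1 k2 k3 k4]] := uo _ _ jk.
  have [|h1 h2 h3 h4] := wP j; first by rewrite eq_sym.
  have [|l1 l2 l3 l4] := wP k; first by rewrite eq_sym.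
  have pc : btw p c (u i).
    by apply: btw_trans px _; rewrite /c; case: (medP medX p x y).
  exists (med medX (t j) (t k) w'); rewrite /t; clear px py.
  by split; walls.
move=> [j|] [k|] //= jk; last first.
- by case: (eqVneq k i) => ?; apply: orthC => //; exact: oy.
- by case: (eqVneq j i) => ? //; exact: oy.
have {}jk : j != k by apply: contraNneq jk => ->.
case: (eqVneq j i) => [ji|ji]; case: (eqVneq k i) => [ki|ki].
- by rewrite ji ki eqxx in jk.
- by apply: orthC; exact: ox.
- exact: ox.
- exact: ot.
Qed.
End Frames.

(** * Intermediate points and linearly ordered intervals *)

Section Geodesic.
Context {R : realType} {X : metricType R} (medX : is_median X).
Implicit Types a b c p q u v w x y z : X.
Local Notation D := mdist.

(** The distance from [a] to the gate of [z] on [[a, b]] is continuous in [z], so by connectedness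
    it takes all values between those at [a] and at [b]. *)
Lemma btw_exists a b t : connected [set: X] -> 0 <= t <= D a b ->
  exists2 z, btw a z b & D a z = t.
Proof.
move=> cX /andP[t0 tab].
pose f z : R := D a (med medX a b z).
have cf : continuous f.
  move=> z; apply/cvgrPdist_lt => e e0.
  have ze : \forall y \near z, D z y < e.
    by have := nbhsx_ballx z e e0; rewrite ballEmdist.
  near=> y; rewrite /f.
  have : D z y < e by near: y.
  have := med_lip medX a b z y.
  have := metric_triangle a (med medX a b z) (med medX a b y).
  have := metric_triangle a (med medX a b y) (med medX a b z).
  rewrite ltr_norml; move: (med medX a b z) (med medX a b y) => u v.
  by rewrite [D v u]metric_sym => *; apply/andP; split; lra.
have /connected_intervalP cE : connected (f @` [set: X]).
  by apply: connected_continuous_connected => //; exact: continuous_subspaceT.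
have [|||z _ <-] := cE 0 (D a b) _ _ t; last by exists (med medX a b z) => //; case: (medP medX a b z).
- by exists a => //; rewrite /f (med_btw medX (btw0 a b)) mdistxx.
- by exists b => //; rewrite /f (med_btw medX (btw1 a b)).
- by rewrite t0 tab.
Unshelve. all: by end_near.
Qed.

Definition chain a b := forall x y, btw a x b -> btw a y b ->
  btw a x y \/ btw a y x.

Lemma chain_btw a b x y : chain a b -> btw a x b -> btw a y b ->
  D a x <= D a y -> btw a x y.
Proof.
move=> ch xab yab xy; case: (ch _ _ xab yab) => // h.
suff -> : y = x by exact: btw1.
by apply: (btw_eq_dist h); apply/eqP; rewrite eq_le xy (btw_le h).
Qed.

Lemma chain_eq a b x y : chain a b -> btw a x b -> btw a y b ->
  D a x = D a y -> x = y.
Proof.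
move=> ch xab yab xy; apply: (btw_eq_dist _ xy).
by apply: (chain_btw ch) => //; rewrite xy.
Qed.

End Geodesic.

(** * Coordinates and the l1 distance *)

Section Coordinates.
Context {R : realType} {N : nat}.
Implicit Types a b s t u : 'I_N -> R.

Definition inbox a b s := forall i, a i <= s i <= b i.

Definition upd s i (r : R) : 'I_N -> R := fun j => if j == i then r else s j.

Definition l1 s t : R := \sum_i `|s i - t i|.

Definition between (x y z : R) := (x <= y <= z) || (z <= y <= x).

Lemma between_l x y : between x x y.
Proof. by rewrite /between lexx /= andbT le_total. Qed.

Lemma between_r x y : between x y y.
Proof. by rewrite /between lexx /= andbT le_total. Qed.

Lemma upd_id s i : upd s i (s i) = s.
Proof. by apply/funext => j; rewrite /upd; case: eqP => // ->. Qed.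

Lemma updE s i r : upd s i r i = r.
Proof. by rewrite /upd eqxx. Qed.

Lemma updNE s i j r : j != i -> upd s i r j = s j.
Proof. by rewrite /upd => /negbTE ->. Qed.

Lemma l1_upd s t i : l1 s t = `|s i - t i| + l1 (upd s i (t i)) t.
Proof.
rewrite /l1 (bigD1 i) //= [in RHS](bigD1 i) //= updE subrr normr0 add0r.
by congr (_ + _); apply: eq_bigr => j ji; rewrite updNE.
Qed.

Lemma l1_upd2 s t i r : l1 (upd s i r) (upd t i r) = l1 (upd s i (t i)) t.
Proof.
by apply: eq_bigr => j _; rewrite /upd; case: eqP => // ->; rewrite !subrr.
Qed.

Lemma l1_axis s i r : l1 s (upd s i r) = `|s i - r|.
Proof.
rewrite (l1_upd s _ i) updE /l1 [X in _ + X]big1 ?addr0 // => j _.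
by rewrite subrr normr0.
Qed.

Lemma l1_between s u t :
  l1 s t = l1 s u + l1 u t <-> forall i, between (s i) (u i) (t i).
Proof.
have key (x y z : R) : between x y z <-> `|x - y| + `|y - z| - `|x - z| = 0.
  rewrite /between; case: (ger0P (x - y)) => h1; case: (ger0P (y - z)) => h2;
    case: (ger0P (x - z)) => h3; case: (lerP x y) => h4;
    case: (lerP y z) => h5; case: (lerP y x) => h6; case: (lerP z y) => h7;
    split => //=; lra.
rewrite /l1 -big_split /=; split => [/esym/eqP|h]; last first.
  by apply: eq_bigr => i _; have /key := h i; lra.
rewrite -subr_eq0 -sumrB psumr_eq0 => [/allP h i|i _]; last first.
  by rewrite subr_ge0 ler_distD.
by apply/key/eqP; apply: h; rewrite mem_index_enum.
Qed.

Lemma l1_ge s t i : `|s i - t i| <= l1 s t.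
Proof. by rewrite /l1 (bigD1 i) //= lerDl sumr_ge0. Qed.

Lemma l1_eq0 s t : l1 s t = 0 -> s = t.
Proof.
move=> h; apply/funext => i; apply/eqP; rewrite -subr_eq0 -normr_le0 -h.
exact: l1_ge.
Qed.

End Coordinates.

(** * Isometric embeddings of l1 boxes *)

Section Box.
Context {R : realType} {X : metricType R} {N : nat}.
Implicit Types (a b s t u : 'I_N -> R) (phi : ('I_N -> R) -> X).
Local Notation D := mdist.

(** Values of [phi] outside the box are arbitrary, so embeddings of growing boxes share one type. *)
Definition isobox a b phi :=
  forall s t, inbox a b s -> inbox a b t -> D (phi s) (phi t) = l1 s t.

Lemma isobox_btw a b phi s u t : isobox a b phi ->
  inbox a b s -> inbox a b u -> inbox a b t ->
  btw (phi s) (phi u) (phi t) <-> forall i, between (s i) (u i) (t i).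
Proof. by move=> iso hs hu ht; rewrite /btw !iso //; exact: l1_between. Qed.

Lemma isobox_inj a b phi s t : isobox a b phi -> inbox a b s -> inbox a b t ->
  phi s = phi t -> s = t.
Proof. by move=> iso hs ht e; apply: l1_eq0; rewrite -iso // e mdistxx. Qed.

Lemma isobox_sub a b a' b' phi : isobox a b phi ->
  (forall i, a i <= a' i) -> (forall i, b' i <= b i) -> isobox a' b' phi.
Proof.
move=> iso aa bb s t hs ht; apply: iso => i; have := hs i; have := ht i;
  have := aa i; have := bb i; lra.
Qed.

Lemma inbox_upd a b s i r : inbox a b s -> a i <= r <= b i ->
  inbox a b (upd s i r).
Proof. by move=> hs hr j; rewrite /upd; case: eqP => [->|]. Qed.

End Box.

(** * Boxes spanned by a frame of maximal size *)

Section MaximalFrames.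
Context {R : realType} {X : metricType R} (medX : is_median X).
Context (cX : connected [set: X]) (N : nat).
Context (maxN : forall (T : finType) p (u : T -> X), frame p u -> (#|T| <= N)%N).
Implicit Types c p q w x y z : X.
Implicit Types (a b s t : 'I_N -> R) (phi : ('I_N -> R) -> X).
Local Notation D := mdist.

(** Two incomparable points of the edge branch off at their median with [p], where the translated
    frame would have [N + 1] members. *)
Lemma chain_frame (u : 'I_N -> X) p i : frame p u -> chain p (u i).
Proof.
move=> fu x y px py; apply: contrapT => /not_orP[xy yx].
have [||v /maxN] := frame_translate (medX := medX) fu px py.
- by move=> e; apply: xy; rewrite {1}e; case: (medP medX p x y).
- by move=> e; apply: yx; rewrite {1}e; case: (medP medX p x y).
by rewrite card_option card_ord ltnn.
Qed.

Lemma box_frame a b phi s (t : 'I_N -> R) : isobox a b phi -> inbox a b s ->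
  inbox a b t -> (forall i, s i <> t i) ->
  frame (phi s) (fun i => phi (upd s i (t i))).
Proof.
move=> iso hs ht st.
have hu i : inbox a b (upd s i (t i)) by exact: inbox_upd.
split=> [i /(isobox_inj iso (hu i) hs) /(congr1 (@^~ i))|i j ij].
  by rewrite updE => e; apply: (st i).
have huu : inbox a b (upd (upd s i (t i)) j (t j)) by exact: inbox_upd.
exists (phi (upd (upd s i (t i)) j (t j))).
split; rewrite (isobox_btw iso) // => k; rewrite /upd;
  case: (eqVneq k j) => [->|kj]; rewrite 1?(eq_sym j) ?(negbTE ij) /=;
  by [exact: between_l|exact: between_r|case: eqP => [->|_];
    by [exact: between_l|exact: between_r]].
Qed.

(** The gates of [z] on the axes at [p] give the coordinates [s], each axis being a chain. No wall
    separates [z] from [phi s]: one that cuts an axis sees both points through the same gate, and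
    one that cuts no axis is constant on the box. *)
Lemma box_convex a b phi z : (forall i, a i < b i) -> isobox a b phi ->
  btw (phi a) z (phi b) -> exists2 s, inbox a b s & z = phi s.
Proof.
move=> ab iso zab.
have ha : inbox a b a by move=> i; rewrite lexx ltW.
have hb : inbox a b b by move=> i; rewrite lexx ltW.
have hu i : inbox a b (upd a i (b i)) by exact: inbox_upd.
set p := phi a; pose u i := phi (upd a i (b i)).
have fu : frame p u.
  by apply: (box_frame iso) => // i e; have := ab i; rewrite e ltxx.
pose zz i := med medX p (u i) z.
have zzb i : btw p (zz i) (u i) by case: (medP medX p (u i) z).
have Dpu i : D p (u i) = b i - a i.
  by rewrite iso // l1_axis distrC gtr0_norm // subr_gt0.
pose s i := a i + D p (zz i).
have hs : inbox a b s.
  by move=> i; have := btw_le (zzb i); have := mdist_ge0 p (zz i);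
    rewrite Dpu /s; lra.
have hsu i : inbox a b (upd a i (s i)) by exact: inbox_upd.
have si i : a i <= s i <= b i by exact: hs.
have Dsu i : D p (phi (upd a i (s i))) = D p (zz i).
  rewrite iso // l1_axis distrC ger0_norm /s; first lra.
  by have := mdist_ge0 p (zz i); lra.
have yy i : phi (upd a i (s i)) = med medX p (u i) (phi s).
  apply: med_uniq; rewrite (isobox_btw iso) // => k; rewrite /upd;
  case: eqP => [->|_];
  by [exact: between_l|exact: between_r|rewrite /between si].
have yz i : phi (upd a i (s i)) = zz i.
  apply: (chain_eq (chain_frame (i := i) fu)) => //.
  by rewrite yy; case: (medP medX p (u i) (phi s)).
exists s => //; apply: (wall_eq medX) => f wf.
have ff i : f (med medX p (u i) (phi s)) = f (zz i) by rewrite -yy yz.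
have [/existsP[i fi]|] := boolP [exists i, f p != f (u i)].
  by have := ff i; rewrite /zz !wall_med //; move: fi; case: eqP => // _ _ ->.
rewrite negb_exists => /forallP fpu.
(* A staircase of corners from [p] to [phi b]; each corner is between its predecessor and some
   [u i], so [f] keeps its value. *)
pose c k := phi (fun i : 'I_N => if (i < k)%N then b i else a i).
have fc k : f (c k) = f p.
  elim: k => [|k IH].
    by congr (f (phi _)); apply/funext => i.
  have [kN|Nk] := ltnP k N; last first.
    rewrite -IH; congr (f (phi _)); apply/funext => i.
    by rewrite !(leq_trans (ltn_ord i)) // leqW.
  pose i := Ordinal kN.
  have hc j : inbox a b (fun i : 'I_N => if (i < j)%N then b i else a i).
    by move=> l; case: ifP => _; [exact: hb|exact: ha].
  have h : btw (c k) (c k.+1) (u i).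
    rewrite (isobox_btw iso) // => l; rewrite /upd ltnS.
    case: eqVneq => [->|]; first by rewrite ltnn leqnn; exact: between_r.
    by rewrite -val_eqE /=; case: (ltngtP l k) => // _ _; exact: between_l.
  have := wf _ _ _ h; rewrite IH; have := fpu i; rewrite negbK => /eqP <-.
  by rewrite eqxx => /eqP.
have fb : f (phi b) = f p.
  by rewrite -(fc N); congr (f (phi _)); apply/funext => i; rewrite ltn_ord.
have := wf _ _ _ zab; rewrite fb eqxx => /eqP ->.
have h : btw (phi a) (phi s) (phi b).
  by rewrite (isobox_btw iso) // => i; rewrite /between; have -> := hs i.
by have := wf _ _ _ h; rewrite fb eqxx => /eqP ->.
Qed.

(** Glues a copy of the chain [[phi s0, e0]] on each point of the face [s i = b i], along the
    rectangles given by the last hypothesis. The final conclusion lets [frame_box] carry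
    orthogonality over to the new points. *)
Lemma box_ext a b phi i s0 e0 :
  isobox a b phi -> inbox a b s0 -> s0 i = b i -> chain (phi s0) e0 ->
  (forall t, inbox a b t -> btw e0 (phi s0) (phi t)) ->
  (forall t, inbox a b t -> t i = b i ->
     exists e, rect (phi s0) (phi t) e e0) ->
  exists phi', [/\ isobox a (upd b i (b i + D (phi s0) e0)) phi',
    forall s, inbox a b s -> phi' s = phi s &
    forall s, inbox a (upd b i (b i + D (phi s0) e0)) s -> b i <= s i ->
      exists2 g, btw (phi s0) g e0 & rect (phi s0) (phi (upd s i (b i))) (phi' s) g].
Proof.
move=> iso hs0 s0i ch out ext.
set c0 := phi s0; set l := D c0 e0; set b' := upd b i (b i + l).
have l0 : 0 <= l by exact: mdist_ge0.
have /choice[g gP] tau : exists x, 0 <= tau <= l -> btw c0 x e0 /\ D c0 x = tau.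
  have [h|_] := boolP (0 <= tau <= l); last by exists c0.
  by have [x h1 h2] := btw_exists medX cX h; exists x.
have /choice[e eP] t : exists e, inbox a b t -> t i = b i ->
    rect c0 (phi t) e e0.
  have [[ht ti]|nt] := pselect (inbox a b t /\ t i = b i); last first.
    by exists c0 => ht ti; case: nt.
  by have [x xP] := ext _ ht ti; exists x.
pose cl s := upd s i (b i).
(* [cl s] is the foot of [s] on the face; above the face, the new point is the gate of
   [g (s i - b i)] on the side from [phi (cl s)] to [e (cl s)]. *)
pose phi' s := if s i <= b i then phi s else
  med medX (phi (cl s)) (e (cl s)) (g (s i - b i)).
have lo s : inbox a b' s -> s i <= b i -> inbox a b s.
  move=> hs si j; have := hs j; rewrite /b' /upd; case: eqP => // -> /andP[-> _].
  by rewrite si.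
have abi : a i <= b i by have := hs0 i; rewrite s0i => /andP[].
have hcl s : inbox a b' s -> inbox a b (cl s).
  move=> hs j; have := hs j; rewrite /cl /b' /upd; case: eqP => // -> _.
  by rewrite abi lexx.
have hi s : inbox a b' s -> b i <= s i -> 0 <= s i - b i <= l.
  by move=> hs; have := hs i; rewrite /b' updE; lra.
have recs s : inbox a b' s -> b i < s i ->
    rect c0 (phi (cl s)) (phi' s) (g (s i - b i)).
  move=> hs si; rewrite /phi' leNgt si /=.
  have [h1 h2] := gP _ (hi _ hs (ltW si)).
  have [|k1 k2 k3 k4] := eP _ (hcl _ hs); first exact: updE.
  by split; walls.
have gate s t : inbox a b' s -> b i < s i -> inbox a b t ->
    btw (phi' s) (phi (cl s)) (phi t).
  move=> hs si ht; have := out _ ht; rewrite -/c0 => o.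
  have [|k1 k2 k3 k4] := eP _ (hcl _ hs); first exact: updE.
  by rewrite /phi' leNgt si /=; walls.
have dist0 s : inbox a b' s -> b i < s i -> D (phi (cl s)) (phi' s) = s i - b i.
  move=> hs si; have [h1 h2] := gP _ (hi _ hs (ltW si)).
  by have [_ <-] := rect_dist (recs _ hs si).
have mixed s t : inbox a b' s -> inbox a b' t -> b i < s i -> t i <= b i ->
    D (phi' s) (phi t) = l1 s t.
  move=> hs ht si ti; rewrite (gate _ _ hs si (lo _ ht ti)).
  rewrite metric_sym dist0 // iso //; [|exact: hcl|exact: lo].
  rewrite (l1_upd s t i) (l1_upd (cl s) t i) [cl s i]updE.
  rewrite (ger0_norm (_ : 0 <= s i - t i)); last lra.
  rewrite ger0_norm ?subr_ge0 //.
  have -> : upd (cl s) i (t i) = upd s i (t i).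
    by apply/funext => j; rewrite /cl /upd; case: eqP.
  lra.
have above s t : inbox a b' s -> inbox a b' t -> b i < s i -> s i <= t i ->
    D (phi' s) (phi' t) = l1 s t.
  move=> hs ht si st; have ti : b i < t i by exact: lt_le_trans st.
  (* The point above the foot of [t] at the height of [s]: it splits the distance into a part
     parallel to the face and a part along the chain. *)
  pose m := med medX (phi (cl t)) (e (cl t)) (g (s i - b i)).
  have [gs1 gs2] := gP _ (hi _ hs (ltW si)).
  have [gt1 gt2] := gP _ (hi _ ht (ltW ti)).
  have gst : btw c0 (g (s i - b i)) (g (t i - b i)).
    by apply: (chain_btw ch) => //; rewrite gs2 gt2; lra.
  have rs := recs _ hs si; have rt := recs _ ht ti.
  have rm : rect c0 (phi (cl t)) m (g (s i - b i)).
    have [|k1 k2 k3 k4] := eP _ (hcl _ ht); first exact: updE.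
    by rewrite /m; split; clear - k1 k2 k3 k4 gs1 medX; walls.
  have [d1 d2] := rect_dist rs; have [d3 d4] := rect_dist rt.
  have [d5 d6] := rect_dist rm.
  have [|r1 r2 r3 r4] := eP _ (hcl _ hs); first exact: updE.
  have [|q1 q2 q3 q4] := eP _ (hcl _ ht); first exact: updE.
  have zs : phi' s = med medX (phi (cl s)) (e (cl s)) (g (s i - b i)).
    by rewrite /phi' leNgt si.
  have zt : phi' t = med medX (phi (cl t)) (e (cl t)) (g (t i - b i)).
    by rewrite /phi' leNgt ti.
  have h1 : btw (phi' s) m (phi' t).
    by rewrite zs zt /m; clear - medX r1 r2 r3 r4 q1 q2 q3 q4 gs1 gt1 gst; walls.
  have h2 : btw (phi (cl t)) m (phi' t).
    by rewrite zt /m; clear - medX r1 r2 r3 r4 q1 q2 q3 q4 gs1 gt1 gst; walls.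
  have rr : rect (phi (cl s)) (phi' s) m (phi (cl t)).
    by rewrite zs /m; split; clear - medX r1 r2 r3 r4 q1 q2 q3 q4 gs1 gt1 gst; walls.
  have [e1 e2] := rect_dist rr.
  have e3 : D m (phi' t) = t i - s i by move: h2; rewrite /btw; lra.
  rewrite h1 e3 -e2 iso; [|exact: hcl|exact: hcl].
  rewrite (l1_upd s t i) -(l1_upd2 s t i (b i)) ler0_norm ?subr_le0 //.
  rewrite opprB addrC; congr (_ + _).
exists phi'; split.
- move=> s t hs ht.
  case: (lerP (s i) (b i)) => si; case: (lerP (t i) (b i)) => ti.
  + by rewrite /phi' si ti iso //; apply: lo.
  + rewrite metric_sym {2}/phi' si mixed // /l1.
    by apply: eq_bigr => j _; rewrite distrC.
  + by rewrite {2}/phi' ti mixed.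
  + have [st|/ltW ts] := lerP (s i) (t i); first exact: above.
    rewrite metric_sym above // /l1.
    by apply: eq_bigr => j _; rewrite distrC.
- by move=> s hs; rewrite /phi'; have /andP[_ ->] := hs i.
- move=> s hs; rewrite le_eqVlt => /orP[/eqP bs|si].
    exists c0; first exact: btw0.
    rewrite bs upd_id /phi' -bs lexx.
    by split; by [exact: btw0|exact: btw1].
  exists (g (s i - b i)); last exact: recs.
  by have [] := gP _ (hi _ hs (ltW si)).
Qed.

Lemma orth_rect p x y g u v : rect p x y g -> btw p g u ->
  orth p x v -> orth p u v -> orth p y v.
Proof.
move=> [h1 h2 h3 h4] pgu [w1 [k1 k2 k3 k4]] [w2 [l1 l2 l3 l4]].
by exists (med medX y w1 w2); split; walls.
Qed.

(** The edges are added one at a time. The box [L k] is flat in the coordinates from [k] on, and its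
    points stay orthogonal to the remaining [u j], which is what [box_ext] requires. *)
Lemma frame_box p (u : 'I_N -> X) : frame p u ->
  exists2 phi, isobox (fun=> 0) (fun i => D p (u i)) phi & phi (fun=> 0) = p.
Proof.
move=> fu; pose L k (i : 'I_N) : R := if (i < k)%N then D p (u i) else 0.
suff H k : (k <= N)%N -> exists phi, [/\ isobox (fun=> 0) (L k) phi,
    phi (fun=> 0) = p & forall s (j : 'I_N), inbox (fun=> 0) (L k) s -> (k <= j)%N ->
      orth p (phi s) (u j)].
  have [phi [iso p0 _]] := H N (leqnn N); exists phi => //.
  by congr (isobox _ _ _): iso; apply/funext => i; rewrite /L ltn_ord.
elim: k => [_|k IH kN].
  exists (fun=> p); split=> // [s t hs ht|s j _ _].
    rewrite mdistxx /l1 big1 // => i _.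
    have := hs i; have := ht i; rewrite /L ltn0.
    by move=> /andP[a1 a2] /andP[a3 a4]; apply/eqP; rewrite normr_eq0; apply/eqP; lra.
  by exists (u j); split; by [exact: btw0|exact: btw1].
have [phi [iso p0 op]] := IH (ltnW kN).
pose i := Ordinal kN.
have L0 j : 0 <= L k j by rewrite /L; case: ifP => _ //; exact: mdist_ge0.
have h0 : inbox (fun=> 0) (L k) (fun=> 0) by move=> j; rewrite lexx L0.
have Lki : L k i = 0 by rewrite /L ltnn.
have LS : upd (L k) i (L k i + D (phi (fun=> 0)) (u i)) = L k.+1.
  apply/funext => j; rewrite /upd p0 Lki add0r /L ltnS.
  case: eqVneq => [->|ji]; first by rewrite leqnn.
  by rewrite ltn_neqAle; move: ji; rewrite -val_eqE /= => ->.
have [||t ht|t ht ti|phi' []] := box_ext (i := i) (e0 := u i) iso h0.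
- by rewrite Lki.
- by rewrite p0; exact: chain_frame.
- rewrite p0; have [w [_ _ h _]] := op t i ht (leqnn k); exact: btwC.
- rewrite p0; have [w h] := op t i ht (leqnn k); by exists w.
rewrite LS => iso' ag top; exists phi'; split=> //.
  by rewrite ag.
move=> s j hs kj.
have [si|si] := lerP (s i) (L k i).
  have hs' : inbox (fun=> 0) (L k) s.
    move=> l; have := hs l; rewrite /L ltnS leq_eqVlt.
    case: eqP => //= li; have -> : l = i by exact/val_inj.
    by rewrite ltnn; move: si; rewrite Lki => -> /andP[->].
  by rewrite ag //; apply: op => //; exact: ltnW.
have [g gu rg] := top s hs (ltW si); rewrite p0 in gu rg.
apply: (orth_rect rg gu); last first.
  by apply: fu.2; apply: contraTneq kj => <-; rewrite ltnn.
apply: op; last exact: ltnW.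
move=> l; have := hs l; rewrite /upd; case: eqP => [->|li]; first by rewrite L0 lexx.
rewrite /L ltnS leq_eqVlt; case: eqP => //= e; by case: li; exact/val_inj.
Qed.

End MaximalFrames.

(** * Stars and directions in a box *)

Section Stars.
Context {R : realType} {X : metricType R}.
Local Notation D := mdist.

Lemma positive_lower_bound (T : finType) (f : T -> R) :
  (forall k, 0 < f k) -> exists2 e, 0 < e & forall k, e <= f k.
Proof.
move=> f0; exists (\big[Order.min/1]_k f k); last first.
  by move=> k; exact: bigmin_le.
by apply/bigmin_gtP.
Qed.

Lemma compact_near_pair (K : set X) (u : nat -> X) e : compact K ->
  (forall n, K (u n)) -> 0 < e -> exists n m, (n < m)%N /\ D (u n) (u m) < e.
Proof.
move=> cK uK e0.
have [|p [_ clp]] := cK (u @ \oo) _; first by exists 0%N => // n _; exact: uK.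
have e2 : 0 < e / 2 by rewrite divr_gt0.
have H M : exists2 n, (M <= n)%N & D p (u n) < e / 2.
  have [||x [[n /= Mn <-]]] := clp (u @` [set n | (M <= n)%N]) (ball p (e / 2)).
  - by exists M => // n Mn; exists n.
  - exact: nbhsx_ballx.
  - by rewrite ballEmdist /= => h; exists n.
have [n _ hn] := H 0%N; have [m nm hm] := H n.+1.
exists n, m; split=> //; move: hn hm (metric_triangle (u n) p (u m)); dlra.
Qed.

Definition star (T : finType) x (y : T -> X) :=
  (forall k, y k <> x) /\ (forall k l, k != l -> btw (y k) x (y l)).

Lemma star_shrink (T : finType) x (y z : T -> X) : star x y ->
  (forall k, btw x (z k) (y k)) -> (forall k, z k <> x) -> star x z.
Proof.
move=> [yx yy] zy zx; split=> // k l kl.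
have := zy k; have := zy l; have := yy _ _ kl.
have := metric_triangle (z k) x (z l); have := metric_triangle (y k) (z k) (y l).
have := metric_triangle (z k) (z l) (y l); dlra.
Qed.

Context {N : nat}.
Implicit Types (a b s t u v : 'I_N -> R) (phi : ('I_N -> R) -> X).

Definition towards s u (d : 'I_N * bool) : bool :=
  if d.2 then s d.1 < u d.1 else u d.1 < s d.1.

Lemma towards_ex s u : u <> s -> exists d, towards s u d.
Proof.
move=> us; apply: contrapT => h; apply: us; apply/funext => i.
case: (ltrgtP (u i) (s i)) => // c; case: h.
  by exists (i, false).
by exists (i, true).
Qed.

Lemma towards_disj a b phi s u v d : isobox a b phi ->
  inbox a b s -> inbox a b u -> inbox a b v -> btw (phi u) (phi s) (phi v) ->
  towards s u d -> towards s v d -> False.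
Proof.
move=> iso hs hu hv /(isobox_btw iso hu hs hv) /(_ d.1).
by rewrite /towards /between; case: ifP => _; lra.
Qed.

(** Each branch moves in at least one of the [2 N] signed coordinate directions, and two branches
    with a common direction would not have [s] between their ends. *)
Lemma box_star a b phi s (T : finType) (u : T -> 'I_N -> R) : isobox a b phi ->
  inbox a b s -> (forall k, inbox a b (u k)) -> star (phi s) (phi \o u) ->
  exists2 d : T -> 'I_N * bool, injective d & forall k, towards s (u k) (d k).
Proof.
move=> iso hs hu [us uu].
have /choice[d dP] k : exists d, towards s (u k) d.
  by apply: towards_ex => e; apply: (us k); rewrite /= e.
exists d => // k l e; apply/eqP; apply: contrapT => /negP /uu /= h.
by apply: (towards_disj iso hs (hu k) (hu l) h (dP k)); rewrite e.
Qed.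

Lemma box_star_card a b phi s (T : finType) (u : T -> 'I_N -> R) :
  isobox a b phi -> inbox a b s -> (forall k, inbox a b (u k)) ->
  star (phi s) (phi \o u) -> (#|T| <= N * 2)%N.
Proof.
move=> iso hs hu st; have [d dinj _] := box_star iso hs hu st.
by have := leq_card d dinj; rewrite card_prod card_ord card_bool.
Qed.

Definition axis_pt a b s (d : 'I_N * bool) :=
  upd s d.1 (if d.2 then b d.1 else a d.1).

Lemma inbox_axis a b s d : inbox a b s -> inbox a b (axis_pt a b s d).
Proof.
move=> hs; apply: inbox_upd => //; have /andP[h1 h2] := hs d.1.
by case: ifP; rewrite lexx (le_trans h1 h2).
Qed.

Lemma axis_btw a b phi s d d' : isobox a b phi -> inbox a b s -> d != d' ->
  btw (phi (axis_pt a b s d)) (phi s) (phi (axis_pt a b s d')).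
Proof.
move=> iso hs dd; rewrite (isobox_btw iso) //; try exact: inbox_axis.
move=> j; rewrite /axis_pt /upd; case: d d' dd => [i e] [i' e'] /= dd.
have := hs j; case: (eqVneq j i) dd => [<-|ji]; last by move=> *; exact: between_l.
case: (eqVneq j i') => [<-|ji'] dd; last by move=> *; exact: between_r.
by rewrite /between; case: e e' dd => [] []; rewrite ?eqxx // => _ /andP[-> ->];
  rewrite ?orbT.
Qed.

End Stars.

(** * Branches leaving a box and the bound on stars *)

Section Branching.
Context {R : realType} {X : metricType R} (medX : is_median X).
Context (cX : connected [set: X]) (N : nat).
Context (maxN : forall (T : finType) p (u : T -> X), frame p u -> (#|T| <= N)%N).
Implicit Types p q w x y z : X.
Implicit Types (a b s t : 'I_N -> R) (phi : ('I_N -> R) -> X).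
Local Notation D := mdist.

Lemma box_bounds a b s : (forall i, a i < b i) -> inbox a b a /\ inbox a b b.
Proof. by move=> ab; split=> i; rewrite lexx ltW. Qed.

Lemma box_gate a b phi z : (forall i, a i < b i) -> isobox a b phi ->
  exists2 s, inbox a b s & forall t, inbox a b t -> btw z (phi s) (phi t).
Proof.
move=> ab iso; have [ha hb] := box_bounds a ab.
have [h _ _] := medP medX (phi a) (phi b) z.
have [s hs e] := box_convex medX maxN ab iso h.
exists s => // t ht; rewrite -e; apply: med_gate.
by rewrite (isobox_btw iso) // => i; rewrite /between ht.
Qed.

(** Replace each branch end by its gate on the box: either some gate is the centre, so that this
    branch leaves the box at once, or the gates form a shorter star inside the box. *)
Lemma star_gate a b phi s (T : finType) (y : T -> X) : (forall i, a i < b i) ->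
  isobox a b phi -> inbox a b s -> star (phi s) y ->
  (exists k, forall t, inbox a b t -> btw (y k) (phi s) (phi t)) \/
  exists2 u : T -> 'I_N -> R, forall k, inbox a b (u k) & star (phi s) (phi \o u).
Proof.
move=> ab iso hs st.
have /choice[u uP] k : exists u, inbox a b u /\
    forall t, inbox a b t -> btw (y k) (phi u) (phi t).
  by have [u] := box_gate (y k) ab iso; exists u.
have [[k ks]|nk] := pselect (exists k, phi (u k) = phi s).
  by left; exists k; rewrite -ks; exact: (uP k).2.
right; exists u => [k|]; first exact: (uP k).1.
apply: (star_shrink st) => k /=; first by apply: btwC; exact: (uP k).2.
by move=> e; apply: nk; exists k.
Qed.

(** Otherwise [z] and the [2 N] ends of the axes through [s] would form a star with too many
    branches. *)
Lemma interior_gate a b phi s z : 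
  (forall (T : finType) x (y : T -> X), star x y -> (#|T| <= N * 2)%N) ->
  isobox a b phi -> (forall i, a i < s i < b i) ->
  (forall t, inbox a b t -> btw z (phi s) (phi t)) -> z = phi s.
Proof.
move=> nostar iso sab gz; apply: contrapT => zs.
have hs : inbox a b s by move=> i; have /andP[/ltW -> /ltW ->] := sab i.
pose y (o : option ('I_N * bool)) := if o is Some d then phi (axis_pt a b s d) else z.
suff /nostar : star (phi s) y.
  by rewrite card_option card_prod card_ord card_bool ltnn.
split=> [[d|]|[d|] [d'|]] //=.
- move=> /(isobox_inj iso (inbox_axis d hs) hs) /(congr1 (@^~ d.1)).
  rewrite /axis_pt updE; have := sab d.1.
  by case: ifP => _ /[swap] ->; rewrite ltxx ?andbF.
- move=> dd; apply: (axis_btw iso hs); by apply: contraNneq dd => ->.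
- by move=> _; apply: btwC; apply: gz; exact: inbox_axis.
- by move=> _; apply: gz; exact: inbox_axis.
Qed.

(* If the gates of [y] and [y'] on a box are opposite corners [x], [x'] of a
   full-dimensional subbox, the part common to [x, y] and [x, y'] would
   span with that subbox a cube of dimension [N + 1]. *)
Lemma branches_apart a b phi s t y y' : isobox a b phi ->
  inbox a b s -> inbox a b t -> (forall i, s i <> t i) ->
  (forall u, inbox a b u -> btw y (phi s) (phi u)) ->
  (forall u, inbox a b u -> btw y' (phi t) (phi u)) ->
  btw y (phi s) y'.
Proof.
move=> iso hs ht st gy gy'.
have [h1 h2 h3] := medP medX y (phi s) y'.
set w := med medX y (phi s) y' in h1 h2 h3.
have [<-//|ws] := pselect (w = phi s).
pose v (o : option 'I_N) := if o is Some i then phi (upd s i (t i)) else w.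
suff /maxN : frame (phi s) v by rewrite card_option card_ord ltnn.
have [f1 f2] := box_frame iso hs ht st.
have ho i : orth (phi s) w (phi (upd s i (t i))).
  have hi : inbox a b (upd s i (t i)) by exact: inbox_upd.
  have h4 := gy _ hi; have h5 := gy' _ hs.
  have h6 : btw (phi s) (phi (upd s i (t i))) (phi t).
    rewrite (isobox_btw iso) // => j; rewrite /upd.
    by case: eqP => [->|_]; [exact: between_r|exact: between_l].
  clearbody w; exists (med medX w (phi (upd s i (t i))) y').
  by clear - medX h1 h2 h3 h4 h5 h6; split; walls.
split=> [[i|]|[i|] [j|]] //= ij.
- by apply: f2; apply: contraNneq ij => ->.
- by apply: orthC.
Qed.

Context (homX : isometry_transitive X) (lcX : locally_compact [set: X]).

(** Cut the branches to a common small length, then move the star by an isometry. *)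
Lemma star_uniform (T : finType) x (y : T -> X) r : star x y -> 0 < r ->
  exists e, [/\ 0 < e, e < r & forall x', exists2 z : T -> X, star x' z &
    forall k, D x' (z k) = e].
Proof.
move=> st r0; have [k|e e0 eP] := @positive_lower_bound R T (fun k => D x (y k)).
  by rewrite mdist_gt0; apply/eqP => /esym; exact: st.1.
pose d := Order.min e (r / 2).
have d0 : 0 < d by rewrite lt_min e0 divr_gt0.
have de : d <= e by rewrite ge_min lexx.
have dr : d < r by rewrite gt_min [r / 2 < r]ltr_pdivrMr // ltr_pMr // ltr1n orbT.
exists d; split=> // x'.
have /choice[z zP] k : exists z, btw x z (y k) /\ D x z = d.
  have [|z h1 h2] := @btw_exists _ _ medX x (y k) d cX; last by exists z.
  by rewrite ltW //= (le_trans de).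
have [f [[g fK gK] fiso] <-] := homX x x'.
have st' : star x z.
  apply: (star_shrink st) => k; first exact: (zP k).1.
  by move=> e'; have := (zP k).2; rewrite e' mdistxx => d'; rewrite -d' ltxx in d0.
exists (f \o z) => [|k]; last by rewrite /= fiso (zP k).2.
split=> [k /(can_inj fK)|k l kl] /=; first exact: st'.1.
by rewrite /btw !fiso; exact: st'.2.
Qed.

Lemma star_card a b phi : (forall i, a i < b i) -> isobox a b phi ->
  forall (T : finType) x (y : T -> X), star x y -> (#|T| <= N * 2)%N.
Proof.
move=> ab iso T x y st; rewrite leqNgt; apply/negP => TN.
have [k0 _] : exists k, k \in T by apply/card_gt0P; exact: leq_ltn_trans TN.
have N0 : (0 < N)%N.
  pose v (_ : unit) := y k0.
  have /maxN : frame x v by split=> [k|[] []] //; exact: st.1.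
  by rewrite card_unit.
have [K xK [cK _]] := @lcX (phi a) I.
have {xK} [r /= r0 rK] : exists2 r : R, 0 < r & ball (phi a) r `<=` K.
  have := xK; rewrite withinET => /nbhs_ballP[r r0 rK].
  by exists r.
have [|e [e0 er eP]] := @star_uniform T x y (r / 2) st; first by rewrite divr_gt0.
have [ha hb] := box_bounds a ab.
pose L := l1 a b.
have L0 : 0 <= L by rewrite /L -(iso _ _ ha hb) mdist_ge0.
(* Distinct positive parameters, at most [1] to stay in the box and at most [r / (2 * (L + r))] to
   stay within [r / 2] of [phi a] on the diagonal, of length [L]. *)
pose c n : R := r / (2 * (L + r)) / n.+1%:R.
pose s n i := a i + c n * (b i - a i).
have Lr : 0 < 2 * (L + r) by rewrite mulr_gt0 // ltr_wpDl.
have c0 n : 0 < c n by rewrite !divr_gt0.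
have c1 n : c n <= r / (2 * (L + r)).
  by rewrite /c ler_pdivrMr ?ltr0Sn // ler_peMr ?ler1n // ltW // divr_gt0.
have c2 : r / (2 * (L + r)) <= 1.
  by rewrite ler_pdivrMr // mul1r; lra.
have c3 : r / (2 * (L + r)) * L <= r / 2.
  rewrite mulrAC ler_pdivrMr // mulrA divfK ?pnatr_eq0 //.
  by rewrite ler_wpM2l ?(ltW r0) // lerDl ltW.
have hs n : inbox a b (s n).
  move=> i; have := ab i; rewrite -subr_gt0 => abi.
  have := mulr_ge0 (ltW (c0 n)) (ltW abi).
  have : c n * (b i - a i) <= b i - a i.
    by rewrite ler_piMl ?(ltW abi) // (le_trans (c1 n)).
  rewrite /s; lra.
have Das n : D (phi a) (phi (s n)) <= r / 2.
  rewrite iso //; have -> : l1 a (s n) = c n * L.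
    rewrite /l1 mulr_sumr; apply: eq_bigr => i _.
    rewrite /s opprD addNKr normrN normrM gtr0_norm // distrC.
    by [].
  by apply: le_trans c3; rewrite ler_wpM2r.
(* A star of more than [2 N] branches cannot shrink into the box, so one of its branches leaves at
   [phi (s n)]. *)
have /choice[z zP] n : exists z, D (phi (s n)) z = e /\
    forall t, inbox a b t -> btw z (phi (s n)) (phi t).
  have [z sz ze] := eP (phi (s n)).
  have [[k kP]|[u uP /(box_star_card iso (hs n) uP)]] := star_gate ab iso (hs n) sz.
    by exists (z k).
  by rewrite leqNgt TN.
have [|n [m [nm]]] := @compact_near_pair R X K z e cK _ e0.
  move=> n; apply: rK; rewrite ballEmdist /=.
  have := metric_triangle (phi a) (phi (s n)) (z n); have := Das n.
  by rewrite (zP n).1; lra.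
rewrite ltNge => /negP; apply.
rewrite -(zP n).1 metric_sym.
suff /btw_le : btw (z n) (phi (s n)) (z m) by [].
apply: (branches_apart iso (hs n) (hs m)) => [i /eqP||]; [|exact: (zP n).2|exact: (zP m).2].
rewrite /s (inj_eq (addrI _)) (inj_eq (mulIf _)); last first.
  by rewrite gt_eqF // subr_gt0.
rewrite /c (inj_eq (mulfI _)); last by rewrite gt_eqF // divr_gt0.
by rewrite (inj_eq invr_inj) eqr_nat eqSS ltn_eqF.
Qed.

End Branching.

(** * Enlarging boxes until they fill the space *)

Section Growth.
Context {R : realType} {X : metricType R} (medX : is_median X).
Context (cX : connected [set: X]) (N : nat).
Context (maxN : forall (T : finType) p (u : T -> X), frame p u -> (#|T| <= N)%N).
Context (maxS : forall (T : finType) x (y : T -> X), star x y -> (#|T| <= N * 2)%N).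
Implicit Types c e p q w x y z : X.
Implicit Types (a b s t u : 'I_N -> R) (phi psi : ('I_N -> R) -> X).
Local Notation D := mdist.

(** The gate of [z] is no farther from [phi s] than [z] is, hence interior to the box, and
    [interior_gate] applies. *)
Lemma box_near a b phi s z (r : R) : (forall i, a i < b i) -> isobox a b phi ->
  inbox a b s -> (forall i, a i + r <= s i <= b i - r) -> D (phi s) z < r ->
  exists2 u, inbox a b u & z = phi u.
Proof.
move=> ab iso hs sr sz; have [u hu gu] := box_gate medX maxN z ab iso.
exists u => //; apply: (interior_gate maxS iso) => // i.
have : `|s i - u i| < r.
  apply: le_lt_trans (l1_ge s u i) _; apply: le_lt_trans sz.
  by rewrite -iso //; exact/btw_le/btwC/gu.
by rewrite ltr_norml; have := sr i; lra.
Qed.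

Lemma axis_chain a b phi s i (t : R) : (forall j, a j < b j) -> isobox a b phi ->
  inbox a b s -> a i <= t <= b i -> chain (phi s) (phi (upd s i t)).
Proof.
move=> ab iso hs ht.
have hst : inbox a b (upd s i t) by exact: inbox_upd.
have key x : btw (phi s) x (phi (upd s i t)) ->
    exists v, [/\ a i <= v <= b i, between (s i) v t & x = phi (upd s i v)].
  move=> sx; have [ha hb] := box_bounds a ab.
  have [|u hu xu] := box_convex medX maxN (z := x) ab iso.
    apply: (btw_convex medX _ _ sx); rewrite (isobox_btw iso) // => j.
      by rewrite /between hs.
    by rewrite /between hst.
  move: sx; rewrite xu (isobox_btw iso) // => su.
  exists (u i); split=> //; first by have := su i; rewrite updE.
  congr phi; apply/funext => j; rewrite /upd; case: eqP => [->//|ji].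
  have := su j; rewrite updNE; last exact/eqP.
  by rewrite /between orbb andbC => h; apply/eqP; rewrite eq_le.
move=> x y /key[v [hv sv ->]] /key[w [hw sw ->]].
have [hv' hw'] : inbox a b (upd s i v) /\ inbox a b (upd s i w).
  by split; exact: inbox_upd.
have [svw|swv] : between (s i) v w \/ between (s i) w v.
  move: sv sw; rewrite /between; case: (lerP v w) => vw; case: (lerP w v) => wv;
    case: (lerP (s i) v) => h1; case: (lerP (s i) w) => h2 /=;
    rewrite ?andbT ?andbF ?orbT ?orbF => *; by [left|right|lra].
- left; rewrite (isobox_btw iso) // => j; rewrite /upd.
  by case: eqP => [->|_] //; exact: between_l.
- right; rewrite (isobox_btw iso) // => j; rewrite /upd.
  by case: eqP => [->|_] //; exact: between_l.
Qed.

(** If both coordinates changed, changing only one or only the other would give two incomparable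
    points. *)
Lemma chain_box a b phi s t i j : isobox a b phi -> inbox a b s ->
  inbox a b t -> chain (phi s) (phi t) -> i != j -> s i <> t i -> s j = t j.
Proof.
move=> iso hs ht ch ij si.
have hi : inbox a b (upd s i (t i)) by exact: inbox_upd.
have hj : inbox a b (upd s j (t j)) by exact: inbox_upd.
have B k : btw (phi s) (phi (upd s k (t k))) (phi t).
  rewrite (isobox_btw iso) //; last exact: inbox_upd.
  by move=> l; rewrite /upd; case: eqP => [->|_]; [exact: between_r|exact: between_l].
have bet (v w : R) : between v w v -> v = w.
  by rewrite /between orbb andbC => h; apply/esym/eqP; rewrite eq_le.
case: (ch _ _ (B i) (B j)); rewrite (isobox_btw iso) //.
  by move=> /(_ i); rewrite updE updNE // => /bet.
by move=> /(_ j); rewrite updE updNE 1?eq_sym // => /bet.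
Qed.

Definition face_interior a b i s :=
  s i = b i /\ forall j, a j < s j /\ (j != i -> s j < b j).

Lemma face_interior_in a b i s : face_interior a b i s -> inbox a b s.
Proof.
case=> si sab j; have [h1 h2] := sab j; rewrite ltW //=.
by have [->|/h2/ltW//] := eqVneq j i; rewrite si.
Qed.

(** A star of [2 N] branches inside the box would use every direction, including the one that points
    out of the face. *)
Lemma face_gate a b phi i s (y : 'I_N * bool -> X) : (forall j, a j < b j) ->
  isobox a b phi -> face_interior a b i s -> star (phi s) y ->
  exists k, forall t, inbox a b t -> btw (y k) (phi s) (phi t).
Proof.
move=> ab iso fs st; have hs := face_interior_in fs.
have [//|[u hu us]] := star_gate medX maxN ab iso hs st.
have [d dinj dP] := box_star iso hs hu us.
have [d' _ dK] := injF_bij dinj.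
have := dP (d' (i, true)); rewrite dK /towards /= fs.1.
by have /andP[_] := hu (d' (i, true)) i; rewrite leNgt => /negbTE ->.
Qed.

Context (r : R) (r0 : 0 < r).
Context (charts : forall x, exists2 psi : ('I_N -> R) -> X,
  isobox (fun=> - r) (fun=> r) psi & psi (fun=> 0) = x).

Let neg_r_lt (i : 'I_N) : - r < r. Proof. by rewrite gtrN. Qed.

Let in0 : inbox (fun=> - r) (fun=> r) (fun _ : 'I_N => 0).
Proof. by move=> i; rewrite oppr_le0 ltW //=. Qed.

Lemma chart_near psi z : isobox (fun=> - r) (fun=> r) psi ->
  D (psi (fun=> 0)) z < r -> exists2 u, inbox (fun=> - r) (fun=> r) u & z = psi u.
Proof.
move=> iso; apply: box_near => // i; by rewrite addNr subrr lexx.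
Qed.

(* A chart [psi] at [phi s] sees the star made of [e] and of the [2 N - 1]
   axes of the box; each of its [2 N] directions is taken by one branch of that
   star.  If [e] and [phi t] were both moving along the axis [j], the branch in
   the direction of [phi t] would be an axis of the box parallel to the face,
   whose opposite axis cannot lie on the axis [j] of [psi]. *)
Lemma transport a b phi i s t e : (forall j, a j < b j) -> isobox a b phi ->
  face_interior a b i s -> inbox a b t -> t i = b i ->
  (forall u, inbox a b u -> btw e (phi s) (phi u)) -> e <> phi s ->
  D (phi s) e < r -> D (phi s) (phi t) < r ->
  exists e', rect (phi s) (phi t) e' e.
Proof.
move=> ab iso fs ht ti ge es er tr; have hs := face_interior_in fs.
have [psi isopsi psi0] := charts (phi s).
have [eh heh eE] : exists2 u, inbox (fun=> - r) (fun=> r) u & e = psi u.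
  by apply: chart_near; rewrite ?psi0.
have [th hth tE] : exists2 u, inbox (fun=> - r) (fun=> r) u & phi t = psi u.
  by apply: chart_near; rewrite ?psi0.
have [/forallP H|] := boolP [forall j, (eh j == 0) || (th j == 0)].
  pose eth j := eh j + th j.
  have heth : inbox (fun=> - r) (fun=> r) eth.
    by move=> j; rewrite /eth; case/orP: (H j) => /eqP ->; rewrite ?add0r ?addr0.
  exists (psi eth); rewrite tE eE -psi0.
  by split; rewrite (isobox_btw isopsi) // => j; rewrite /eth;
    case/orP: (H j) => /eqP ->; rewrite ?add0r ?addr0;
    by [exact: between_l|exact: between_r].
rewrite negb_forall => /existsP[j]; rewrite negb_or => /andP[ej tj]; exfalso.
(* [eta] is the common length of the axes at [s]: short enough for the chart and for the box. The
   bound [b i - s i] is zero and is left out, as [e] takes the place of the outward axis. *)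
pose m k := Order.min (r / 2) (Order.min (s k - a k)
  (if k == i then r else b k - s k)).
have [k|eta eta0 etam] := @positive_lower_bound R 'I_N m.
  rewrite !lt_min divr_gt0 //=; have [h1 h2] := fs.2 k; rewrite subr_gt0 h1 /=.
  by case: eqVneq => // /h2; rewrite subr_gt0.
have etaP k : [/\ eta <= r / 2, eta <= s k - a k & k != i -> eta <= b k - s k].
  have := etam k; rewrite !le_min => /and3P[-> -> h]; split=> // ki.
  by move: h; rewrite (negbTE ki).
pose ax := axis_pt (fun k => s k - eta) (fun k => s k + eta) s.
have hax d : d != (i, true) -> inbox a b (ax d).
  move=> di; apply: inbox_upd => //; have [_ h1 h2] := etaP d.1.
  have /andP[h3 h4] := hs d.1; case: d di h1 h2 h3 h4 => k [] /= di h1 h2 h3 h4.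
    have /h2 : k != i by apply: contraNneq di => ->.
    lra.
  lra.
have Dax d : d != (i, true) -> D (phi s) (phi (ax d)) = eta.
  move=> di; rewrite iso //; last exact: hax.
  by rewrite l1_axis; case: ifP => _; rewrite opprD ?opprK addNKr ?normrN gtr0_norm.
pose y d := if d == (i, true) then e else phi (ax d).
have ysub d d' : d != (i, true) -> d' != (i, true) -> d != d' ->
    btw (phi (ax d)) (phi s) (phi (ax d')).
  move=> di di' dd; rewrite (isobox_btw iso) //; try exact: hax.
  move=> k; rewrite /ax /axis_pt /upd; case: d d' dd {di di'} => [l v] [l' v'] /= dd.
  case: (eqVneq k l) dd => [<-|kl]; last by move=> *; exact: between_l.
  case: (eqVneq k l') => [<-|kl'] dd; last by move=> *; exact: between_r.
  by rewrite /between; case: v v' dd => [] []; rewrite ?eqxx // => _; lra.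
have sty : star (psi (fun=> 0)) y.
  rewrite psi0; split=> [d|d d' dd]; rewrite /y.
    case: eqP => // /eqP /Dax dd e'; move: dd; rewrite e' mdistxx => dd.
    by rewrite -dd ltxx in eta0.
  case: (eqVneq d (i, true)) => [di|di]; case: (eqVneq d' (i, true)) => [di'|di'].
  - by rewrite di di' eqxx in dd.
  - by apply: ge; exact: hax.
  - by apply: btwC; apply: ge; exact: hax.
  - exact: ysub.
have etar : eta < r.
  by have [h _ _] := etaP i; apply: le_lt_trans h _; rewrite ltr_pdivrMr // ltr_pMr // ltr1n.
have /choice[yh yhP] d : exists u, inbox (fun=> - r) (fun=> r) u /\ y d = psi u.
  have [|u] := @chart_near psi (y d) isopsi; last by exists u.
  rewrite psi0 /y; case: eqP => // /eqP di; by rewrite Dax.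
have yE : y = psi \o yh by apply/funext => d; exact: (yhP d).2.
have hyh d := (yhP d).1.
rewrite yE in sty.
have [d dinj dP] := box_star isopsi in0 hyh sty.
have [d' d'K dK] := injF_bij dinj.
pose dt := (j, 0 < th j); pose de := (j, ~~ (0 < th j)).
have tdt : towards (fun=> 0) th dt.
  by rewrite /dt /towards /=; move: tj; case: ltrgtP.
have disj u v dd : inbox (fun=> - r) (fun=> r) u -> inbox (fun=> - r) (fun=> r) v ->
    btw (psi u) (phi s) (psi v) -> towards (fun=> 0) u dd ->
    towards (fun=> 0) v dd -> False.
  by rewrite -psi0; exact: towards_disj.
have ecs : btw (psi eh) (phi s) (psi th) by rewrite -eE -tE; exact: ge.
have ede : towards (fun=> 0) eh de.
  have := disj _ _ dt heh hth ecs; rewrite /dt /de /towards /=.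
  by move: tj ej; case: (ltrgtP (th j) 0) => // ? _; case: (ltrgtP (eh j) 0) => // ? _;
    move=> /(_ isT isT).
pose k := d' dt.
have tk : towards (fun=> 0) (yh k) dt by have := dP k; rewrite dK.
have yi : yh (i, true) = eh.
  by apply: (isobox_inj isopsi (hyh _) heh); rewrite -eE -(yhP _).2 /y eqxx.
have ki : k != (i, true).
  by apply/eqP => ki; move: tk; rewrite ki yi => tk; exact: (disj eh th dt).
have yk : psi (yh k) = phi (ax k) by rewrite -(yhP k).2 /y (negbTE ki).
have kli : k.1 != i.
  apply/eqP => kli.
  have kf : k = (i, false) by case: (k) ki kli => l [] /= + E; rewrite E ?eqxx.
  apply: (disj (yh k) th dt) => //; rewrite yk -tE (isobox_btw iso) //; last exact: hax.
  move=> l; rewrite kf /ax /axis_pt /upd /=; case: eqP => [->|_]; last exact: between_l.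
  by rewrite ti fs.1; exact: between_r.
pose k' := (k.1, ~~ k.2).
have kk' : k != k' by apply/eqP => /(congr1 snd) /=; case: (k.2).
have ki' : k' != (i, true) by apply: contraNneq kli => /(congr1 fst) /= ->.
have yk' : psi (yh k') = phi (ax k') by rewrite -(yhP k').2 /y (negbTE ki').
have skk : btw (psi (yh k)) (phi s) (psi (yh k')) by rewrite yk yk'; exact: ysub.
have ch : chain (psi (yh k)) (psi (yh k')).
  rewrite yk yk'.
  have -> : ax k' = upd (ax k) k.1 (ax k' k.1).
    by apply/funext => l; rewrite /ax /axis_pt /upd /= eqxx; case: eqP.
  by apply: axis_chain ab iso _ _; exact: hax.
have jj : (d k').1 != j.
  apply/eqP => kj.
  have [h|h] : d k' = dt \/ d k' = de.
    case: (d k') kj => l v /= ->; rewrite /dt /de.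
    by case: v; case: (0 < th j); by [left|right].
  - by have := dinj _ _ (etrans h (esym (dK dt))) => /eqP; rewrite eq_sym (negbTE kk').
  - apply: (disj (yh k') eh de) => //; last by rewrite -h.
    rewrite yk' -eE; apply: btwC; apply: ge; exact: hax.
have dne (u v : 'I_N -> R) dd : inbox (fun=> - r) (fun=> r) u ->
    inbox (fun=> - r) (fun=> r) v -> btw (psi u) (phi s) (psi v) ->
    towards (fun=> 0) u dd -> u dd.1 <> v dd.1.
  move=> hu hv uv tu e'; apply: (disj u v dd) => //.
  by move: tu; rewrite /towards e'.
(* The interval between the opposite axis ends [k] and [k'] is a chain, yet in the chart it would
   move both [j] and the distinct coordinate [(d k').1]. *)
apply: (dne (yh k) (yh k') dt) => //.
apply: (chain_box isopsi (hyh k) (hyh k') ch jj) => e'.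
by apply: (dne (yh k') (yh k) (d k')) => //; exact: btwC.
Qed.

(** The axes of a chart at [phi s] form a star of [2 N] branches, one of which must leave the box.
    The length [r / 2] keeps its end strictly within the reach [r] of [transport]. *)
Lemma face_branch a b phi i s : (forall j, a j < b j) ->
  isobox a b phi -> face_interior a b i s ->
  exists e, [/\ D (phi s) e = r / 2, chain (phi s) e &
    forall t, inbox a b t -> btw e (phi s) (phi t)].
Proof.
move=> ab iso fs; have [psi isopsi psi0] := charts (phi s).
have r2 : 0 < r / 2 by rewrite divr_gt0.
have r2r : r / 2 <= r by have := r0; lra.
have iso2 : isobox (fun=> - (r / 2)) (fun=> r / 2) psi.
  by apply: isobox_sub isopsi _ _ => j //; rewrite lerN2.
have h0 : inbox (fun=> - (r / 2)) (fun=> r / 2) (fun _ : 'I_N => 0).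
  by move=> j; rewrite oppr_le0 ltW //=.
pose y d := psi (axis_pt (fun=> - (r / 2)) (fun=> r / 2) (fun=> 0) d).
have Dy d : D (phi s) (y d) = r / 2.
  rewrite -psi0 iso2 //; last exact: inbox_axis.
  by rewrite l1_axis sub0r normrN; case: ifP => _; rewrite ?normrN gtr0_norm.
have [|k kP] := face_gate (y := y) ab iso fs.
  rewrite -psi0; split=> [d|d d' dd]; last exact: axis_btw iso2 h0 dd.
  by rewrite psi0 => e; have := Dy d; rewrite e mdistxx => h; rewrite -h ltxx in r2.
exists (y k); split=> //; rewrite -psi0; apply: (axis_chain _ iso2 h0).
  by move=> j; rewrite gtrN.
by case: ifP => _; move: r2; lra.
Qed.

(** [transport] is local, so [e] is carried along the straight segment from [s] to [t] in steps of
    length at most [r / 2]. *)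
Lemma face_rect a b phi i s e : (forall j, a j < b j) ->
  isobox a b phi -> face_interior a b i s -> D (phi s) e = r / 2 ->
  (forall t, inbox a b t -> btw e (phi s) (phi t)) ->
  forall t, inbox a b t -> t i = b i -> exists e', rect (phi s) (phi t) e' e.
Proof.
move=> ab iso fs De ge; have hs := face_interior_in fs.
have r2 : 0 < r / 2 by rewrite divr_gt0.
have r2r : r / 2 < r by have := r0; lra.
suff H n t : inbox a b t -> t i = b i -> l1 s t <= n%:R * (r / 2) ->
    exists e', rect (phi s) (phi t) e' e.
  move=> t ht ti; apply: (H (Num.truncn (l1 s t / (r / 2))).+1) => //.
  rewrite -ler_pdivrMr //; apply: ltW; exact: truncnS_gt.
elim: n t => [|n IH] t ht ti.
  rewrite mul0r => st; have <- : s = t.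
    apply: l1_eq0; apply/eqP; rewrite eq_le st /= /l1; exact: sumr_ge0.
  by exists e; split; by [exact: btw0|exact: btw1].
move=> st.
(* All but the last of [n + 1] equal steps. As [q < 1], the base point [t'] of the last step is
   interior to the face even if [t] is on its boundary. *)
pose q : R := n%:R / n.+1%:R.
have n0 : 0 < n.+1%:R :> R by rewrite ltr0Sn.
have q0 : 0 <= q by rewrite divr_ge0 // ltW.
have q1 : q < 1 by rewrite ltr_pdivrMr // mul1r ltr_nat.
pose t' j := s j + q * (t j - s j).
have ft' : face_interior a b i t'.
  split; first by rewrite /t' ti fs.1 subrr mulr0 addr0.
  move=> j; have [h1 h2] := fs.2 j; have /andP[h3 h4] := ht j.
  have e1 : t' j = (1 - q) * s j + q * t j.
    by rewrite /t' mulrBr mulrBl mul1r; lra.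
  have q1' : 0 < 1 - q by rewrite subr_gt0.
  split=> [|/h2 {}h2]; rewrite e1.
    have -> : a j = (1 - q) * a j + q * a j by rewrite -mulrDl subrK mul1r.
    by rewrite ltr_leD // ?ltr_pM2l // ler_wpM2l.
  have -> : b j = (1 - q) * b j + q * b j by rewrite -mulrDl subrK mul1r.
  by rewrite ltr_leD // ?ltr_pM2l // ler_wpM2l.
have ht' := face_interior_in ft'.
have st' : l1 s t' = q * l1 s t.
  rewrite /l1 mulr_sumr; apply: eq_bigr => j _.
  by rewrite /t' opprD addNKr normrN normrM ger0_norm // distrC.
have t't : l1 t' t = (1 - q) * l1 s t.
  rewrite /l1 mulr_sumr; apply: eq_bigr => j _.
  have -> : t' j - t j = (1 - q) * (s j - t j).
    by rewrite /t' !mulrBr !mulrBl !mul1r; lra.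
  by rewrite normrM ger0_norm // subr_ge0 ltW.
have [||e' re'] := IH t' ht'; first exact: ft'.1.
  rewrite st'; apply: (@le_trans _ _ (q * (n.+1%:R * (r / 2)))).
    by rewrite ler_wpM2l.
  by rewrite mulrA /q divfK // gt_eqF.
have [r1 r2' r3 r4] := re'; have [d1 d2] := rect_dist re'.
have ge' u : inbox a b u -> btw e' (phi t') (phi u).
  by move=> /ge h; clear - medX h r1 r2' r3 r4; walls.
have [|||e'' re''] := transport ab iso ft' ht ti ge'.
- move=> h; rewrite -h mdistxx in d2; move: De r2; rewrite d2 => <-; by rewrite ltxx.
- by rewrite -d2 De.
- rewrite iso // t't; apply: le_lt_trans r2r.
  apply: (@le_trans _ _ ((1 - q) * (n.+1%:R * (r / 2)))).
    by rewrite ler_wpM2l // subr_ge0 ltW.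
  have -> : 1 - q = n.+1%:R^-1.
    have nz : n.+1%:R != 0 :> R by rewrite gt_eqF.
    by apply: (mulIf nz); rewrite mulrBl mul1r /q divfK // mulVf // -natrB // subSnn.
  by rewrite mulKf // gt_eqF.
have gt := ge _ ht; have [l1 l2 l3 l4] := re''; exists e''.
by split; clear - medX gt r1 r2' r3 r4 l1 l2 l3 l4; walls.
Qed.

Lemma box_up a b phi i : (forall j, a j < b j) -> isobox a b phi ->
  exists2 phi', isobox a (upd b i (b i + r / 2)) phi' &
    forall s, inbox a b s -> phi' s = phi s.
Proof.
(* The centre of the face. *)
move=> ab iso; pose s j := if j == i then b i else (a j + b j) / 2.
have fs : face_interior a b i s.
  split=> [|j]; rewrite /s ?eqxx //; have := ab j; case: eqVneq => [->|_] h; first by split.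
  by split=> [|_]; lra.
have [e [De ch ge]] := face_branch ab iso fs.
have hs := face_interior_in fs.
have [phi' [iso' ag _]] := box_ext medX cX iso hs fs.1 ch ge
  (face_rect ab iso fs De ge).
by exists phi' => //; rewrite -De.
Qed.

Let opp (s : 'I_N -> R) := fun i => - s i.

Lemma isobox_opp a b phi : isobox a b phi -> isobox (opp b) (opp a) (phi \o opp).
Proof.
move=> iso s t hs ht /=; rewrite iso.
- by apply: eq_bigr => i _; rewrite /opp -opprD normrN.
- by move=> i; have := hs i; rewrite /opp; lra.
- by move=> i; have := ht i; rewrite /opp; lra.
Qed.

Lemma box_down a b phi i : (forall j, a j < b j) -> isobox a b phi ->
  exists2 phi', isobox (upd a i (a i - r / 2)) b phi' &
    forall s, inbox a b s -> phi' s = phi s.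
Proof.
move=> ab iso.
have oK (s : 'I_N -> R) : opp (opp s) = s by apply/funext => j; rewrite /opp opprK.
have [|phi' iso' ag] := box_up i _ (isobox_opp iso).
  by move=> j; rewrite /opp ltrN2.
exists (phi' \o opp).
  have := isobox_opp iso'; rewrite oK; congr (isobox _ _ _).
  by apply/funext => j; rewrite /opp /upd; case: eqP => _; rewrite ?opprD opprK.
move=> s hs; rewrite /= ag /= ?oK // => j.
by have := hs j; rewrite /opp; lra.
Qed.

Lemma box_grow a b phi : (forall j, a j < b j) -> isobox a b phi ->
  exists2 phi', isobox (fun j => a j - r / 2) (fun j => b j + r / 2) phi' &
    forall s, inbox a b s -> phi' s = phi s.
Proof.
(* Induction on the list of coordinates treated so far; [enum 'I_N] counts each coordinate once. *)
suff H l : forall a b phi, (forall j, a j < b j) -> isobox a b phi ->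
  exists2 phi', isobox (fun j => a j - (r / 2) *+ count_mem j l)
      (fun j => b j + (r / 2) *+ count_mem j l) phi' &
    forall s, inbox a b s -> phi' s = phi s.
  move=> /(H (enum 'I_N)) {}H /H [phi' iso' ag]; exists phi' => //.
  by congr (isobox _ _ _): iso'; apply/funext => j;
    rewrite count_uniq_mem ?enum_uniq // mem_enum.
elim: l => [|i l IH] {}a {}b {}phi ab iso.
  exists phi => //; congr (isobox _ _ _): iso; apply/funext => j;
  by rewrite mulr0n ?subr0 ?addr0.
have r2 : 0 < r / 2 by rewrite divr_gt0.
have [phi1 iso1 ag1] := box_up i ab iso.
have ab1 j : a j < upd b i (b i + r / 2) j.
  by have := ab j; rewrite /upd; case: eqP => [->|//]; lra.
have [phi2 iso2 ag2] := box_down i ab1 iso1.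
have ab2 j : upd a i (a i - r / 2) j < upd b i (b i + r / 2) j.
  by have := ab1 j; rewrite {2}/upd; case: eqP => [->|//]; lra.
have [phi3 iso3 ag3] := IH _ _ _ ab2 iso2.
exists phi3.
  congr (isobox _ _ _): iso3; apply/funext => j; rewrite /upd /= mulrnDr eq_sym;
    case: eqVneq => [->|_]; rewrite ?mulr1n ?mulr0n ?add0r //; lra.
have sub s : inbox a b s -> inbox a (upd b i (b i + r / 2)) s.
  by move=> hs j; have := hs j; rewrite /upd; case: eqP => [->|//]; lra.
move=> s hs; rewrite ag3 ?ag2 ?ag1 //; first exact: sub.
move=> j; have := sub s hs j; move: (upd b i _ j) => v; rewrite /upd; case: eqP => [->|//]; lra.
Qed.

(** [Phi] is the common extension of embeddings of cubes of half-side [rad n]. It is onto because,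
    by [box_near], such a cube contains the open ball of radius [rad n] around its centre. *)
Lemma box_exhaust x : exists Phi : ('I_N -> R) -> X,
  (forall s t, D (Phi s) (Phi t) = l1 s t) /\ forall z, exists s, Phi s = z.
Proof.
pose rad n : R := r + (r / 2) *+ n.
have r2 : 0 < r / 2 by rewrite divr_gt0.
have rad0 n : 0 < rad n by rewrite ltr_wpDr // mulrn_wge0 // ltW.
pose box n phi := isobox (fun=> - rad n) (fun=> rad n) phi.
pose inb n s := inbox (fun=> - rad n) (fun=> rad n) s.
have ablt n (j : 'I_N) : - rad n < rad n by rewrite gtrN.
have [phi0 iso0 _] := charts x.
(* The box condition is a premise, so that [F] is total and the sequence can be defined before its
   terms are known to be isometric. *)
have /choice[F FP] (np : nat * (('I_N -> R) -> X)) : exists phi', box np.1 np.2 ->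
    box np.1.+1 phi' /\ forall s, inb np.1 s -> phi' s = np.2 s.
  case: np => n phi /=; have [iso|niso] := pselect (box n phi); last by exists phi.
  have [phi' iso' ag] := box_grow (ablt n) iso; exists phi' => _; split=> //.
  by congr (isobox _ _ _): iso'; apply/funext => j; rewrite /rad mulrS; lra.
pose fix f n := if n is m.+1 then F (m, f m) else phi0.
have fbox n : box n (f n).
  elim: n => [|n IH] /=; last by have [] := FP (n, f n) IH.
  by congr (isobox _ _ _): iso0; apply/funext => j; rewrite /rad mulr0n addr0.
have inbS n k s : inb n s -> inb (n + k)%N s.
  move=> hs j; have := hs j; rewrite /rad mulrnDr.
  have : 0 <= (r / 2) *+ k by rewrite mulrn_wge0 // ltW.
  lra.
have fag n k s : inb n s -> f (n + k)%N s = f n s.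
  move=> hs; elim: k => [|k <-]; first by rewrite addn0.
  rewrite addnS /=; have [_] := FP ((n + k)%N, f (n + k)%N) (fbox _); apply.
  exact: inbS.
have ex s : exists n, inb n s.
  pose n := (Num.truncn (l1 s (fun=> 0) / (r / 2))).+1; exists n => j.
  have : l1 s (fun=> 0) <= (r / 2) *+ n.
    rewrite -mulr_natr mulrC -ler_pdivrMr //; apply: ltW; exact: truncnS_gt.
  have := l1_ge s (fun=> 0) j; rewrite subr0 => h1 h2.
  by rewrite -ler_norml; apply: le_trans h1 (le_trans h2 _); rewrite lerDr ltW.
have /choice[Phi PhiP] s : exists y, forall n, inb n s -> f n s = y.
  have [n hn] := ex s; exists (f n s) => m hm.
  by rewrite -(fag m n) // addnC fag.
exists Phi; split=> [s t|z].
  have [n hn] := ex s; have [m hm] := ex t.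
  have hs := inbS n m s hn; have ht : inb (n + m)%N t by rewrite addnC; exact: inbS.
  by rewrite -(PhiP _ _ hs) -(PhiP _ _ ht); exact: fbox.
pose o : 'I_N -> R := fun=> 0.
pose n := (Num.truncn (D (Phi o) z / (r / 2))).+1.
have ho : inb n o by move=> j; rewrite oppr_le0 ltW /=.
have zn : D (Phi o) z < rad n.
  apply: (@lt_trans _ _ ((r / 2) *+ n)); last by rewrite ltrDr.
  by rewrite -mulr_natr mulrC -ltr_pdivrMr //; exact: truncnS_gt.
have [||u hu ->] := box_near (r := rad n) (z := z) (ablt n) (fbox n) ho.
- by move=> j; rewrite addNr subrr lexx.
- by rewrite PhiP.
by exists u; rewrite (PhiP u n hu).
Qed.

End Growth.

(** * Charts of uniform size at all points *)

Section Homogeneous.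
Context {R : realType} {X : metricType R} (medX : is_median X).
Context (cX : connected [set: X]) (N : nat).
Context (maxN : forall (T : finType) p (u : T -> X), frame p u -> (#|T| <= N)%N).
Context (homX : isometry_transitive X).
Local Notation D := mdist.

(** Around the centre of the box spanned by the frame, a cube with side the lower bound [e] of the
    edge lengths fits; an isometry takes the centre to [x]. *)
Lemma charts_exist p (u : 'I_N -> X) : frame p u ->
  exists2 r, 0 < r & forall x, exists2 psi : ('I_N -> R) -> X,
    isobox (fun=> - r) (fun=> r) psi & psi (fun=> 0) = x.
Proof.
move=> fu; have [phi iso _] := frame_box medX cX maxN fu.
pose L i := D p (u i).
have [i|e e0 eL] := @positive_lower_bound R 'I_N L.
  by rewrite mdist_gt0; apply/eqP => /esym; exact: fu.1.
exists (e / 2) => [|x]; first by rewrite divr_gt0.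
have [f [_ fiso] fx] := homX (phi (fun i => 0 + L i / 2)) x.
exists (fun s => f (phi (fun i => s i + L i / 2))) => //.
move=> s t hs ht; rewrite fiso iso.
- by apply: eq_bigr => i _ /=; rewrite opprD addrACA subrr addr0.
- by move=> i; have := hs i; have := eL i; rewrite -/(L i); lra.
- by move=> i; have := ht i; have := eL i; rewrite -/(L i); lra.
Qed.

End Homogeneous.

Theorem theorem1p1 (R : realType) (X : metricType R) :
  [set: X] !=set0 ->
  is_median X ->
  connected [set: X] ->
  locally_compact [set: X] ->
  finite_rank X ->
  isometry_transitive X ->
  exists n : nat, isometric X (l1space R n).
Proof.
move=> [x0 _] medX cX lcX [rk rkX] homX.
pose P n := `[< exists p (u : 'I_n -> X), frame p u >].
have P0 : exists n, P n.
  (* The empty frame, the only one in a one-point space, for which [N = 0]. *)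
  by exists 0%N; apply/asboolP; exists x0, (fun=> x0); split=> [[]|[]].
have Prk n : P n -> (n <= rk)%N.
  by move=> /asboolP[p [u /(frame_rank medX rkX)]]; rewrite card_ord.
have [N /asboolP[p [u fu]] maxP] := ex_maxnP P0 Prk.
have maxN (T : finType) q (v : T -> X) : frame q v -> (#|T| <= N)%N.
  move=> [v1 v2]; apply: maxP; apply/asboolP; exists q, (v \o enum_val).
  by split=> [i|i j ij] /=; [exact: v1|apply: v2; rewrite (inj_eq enum_val_inj)].
have [r r0 charts] := charts_exist medX cX maxN homX fu.
have [psi isopsi _] := charts x0.
have maxS := star_card medX cX maxN homX lcX (fun _ : 'I_N => _ : - r < r) isopsi.
have [|Phi [Piso Psurj]] := box_exhaust medX cX maxN _ r0 charts x0.
  by apply: maxS; rewrite gtrN.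
have Pinj s t : Phi s = Phi t -> s = t.
  by move=> e; apply: l1_eq0; rewrite -Piso e mdistxx.
have /choice[g gP] := Psurj.
pose F z : l1space R N := \row_i g z i.
pose G (v : l1space R N) := Phi (fun i => (v : 'rV[R]_N) ord0 i).
have gF z : (fun i => (F z : 'rV[R]_N) ord0 i) = g z.
  by apply/funext => i; rewrite mxE.
exists N, F; split.
  exists G => [z|v]; first by rewrite /G gF.
  apply/rowP => i; rewrite mxE; have /Pinj -> := gP (G v); by [].
move=> x y; rewrite -[x in RHS]gP -[y in RHS]gP Piso.
by apply: eq_bigr => i _; rewrite !mxE.
Qed.
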